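(* Let $\mathbb K$ be an algebraically closed field of characteristic $3$ and let $\mathfrak g=\mathfrak{brj}(2;3)=\mathfrak g(A)$ be the Lie superalgebra with Cartan matrix $$A=\begin{pmatrix}0&-1\\-2&1\end{pmatrix},$$ both Chevalley generators $x_1,x_2$ (and $y_1,y_2$) being odd, with positive basis elements $x_1$, $x_2$, $x_3=[x_1,x_2]$, $x_4=[x_2,x_2]$, $x_5=[x_2,[x_1,x_2]]$, $x_6=[[x_1,x_2],[x_2,x_2]]$, $x_7=[[x_2,x_2],[x_2,[x_1,x_2]]]$, $x_8=[[x_2,[x_1,x_2]],[x_2,[x_1,x_2]]]$, negative basis elements $y_1,\dots,y_8$ given by the same expressions in $y_1,y_2$, and $h_i=[x_i,y_i]$ for $i=1,2$. Then: (a1) for a basis of $H^1(\mathfrak g;\mathfrak g)$ one can take the classes of the two derivations $D$ and $\theta D\theta^{-1}$, where $D$ is the odd derivation given by $$x_2\mapsto -y_4,\quad x_4\mapsto 2y_2,\quad x_6\mapsto x_1,\quad x_7\mapsto -x_3,\quad y_1\mapsto -2y_6,\quad y_3\mapsto y_7,$$ all other basis elements being sent to $0$, and $\theta$ is the automorphism of $\mathfrak g$ given by $x_i\mapsto y_i$, $y_i\mapsto -x_i$ $(i=1,2)$; (a2) $H^2(\mathfrak g)=0$.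
   Context: For an invertible $n\times n$ matrix $A$ with prescribed parities $p_1,\dots,p_n$: $\tilde{\mathfrak g}(A)$ is the Lie superalgebra generated by even $h_i$ and $x_i,y_i$ of parity $p_i$ with relations $[h_i,h_j]=0$, $[h_i,x_j]=A_{ij}x_j$, $[h_i,y_j]=-A_{ij}y_j$, $[x_i,y_j]=\delta_{ij}h_i$; $\mathfrak g(A)$ is its quotient by the largest ideal that is graded with respect to the $\mathbb Z^n$-grading $\deg x_i=e_i=-\deg y_i$ and intersects $\mathfrak h=\operatorname{Span}(h_i)$ trivially. For $p=3$, Lie superalgebras satisfy also $[x,[x,x]]=0$ for odd $x$. $H^1(\mathfrak g;\mathfrak g)$ is the superspace of all (even and odd) derivations, $D[x,y]=[Dx,y]+(-1)^{p(D)p(x)}[x,Dy]$, modulo inner ones. $H^2(\mathfrak g)$ (trivial coefficients, both parities): 2-cocycles are bilinear forms with $\omega(x,y)=-(-1)^{p(x)p(y)}\omega(y,x)$, $\omega([x,y],z)=\omega(x,[y,z])-(-1)^{p(x)p(y)}\omega(y,[x,z])$ and $\omega(x,[x,x])=0$ for odd $x$; coboundaries are $f([x,y])$ with $f$ linear. *)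

(* Defs.v *)
From HB Require Import structures.
From mathcomp Require Import all_boot all_algebra.
From mathcomp Require Import generic_quotient ring_quotient.
From mathcomp Require Import boolp functions.
From mathcomp Require Import freeg zify ring.

Set Implicit Arguments.
Unset Strict Implicit.
Unset Printing Implicit Defensive.

Import GRing.Theory.
Local Open Scope ring_scope.
Local Open Scope quotient_scope.

Definition is_basis (K : fieldType) (V : lmodType K) (s : seq V) : Prop :=
  (forall c : 'I_(size s) -> K,
     \sum_(i < size s) c i *: s`_i = 0 -> forall i, c i = 0) /\
  (forall v, exists c : 'I_(size s) -> K, v = \sum_(i < size s) c i *: s`_i).

Record subspace (K : fieldType) (V : lmodType K) := Subspace {
  ssmem :> {pred V};
  ssmemP : submod_closed ssmem
}.

HB.instance Definition _ (K : fieldType) (V : lmodType K) (W : subspace V) :=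
  GRing.isSubmodClosed.Build K V (ssmem W) (ssmemP W).

Section QuotientSpace.
Variables (K : fieldType) (V : lmodType K) (W : subspace V).

Definition lquot : Type := Quotient.quot (ssmem W).
HB.instance Definition _ := GRing.Zmodule.on lquot.

Definition lpi (v : V) : lquot := \pi_(Quotient.quot (ssmem W)) v.

Lemma lpi_eq u v : lpi u = lpi v <-> u - v \in W.
Proof.
rewrite /lpi; split=> [/eqP|h]; first by rewrite -Quotient.idealrBE.
by apply/eqP; rewrite -Quotient.idealrBE.
Qed.

Lemma lpi_surj (q : lquot) : lpi (repr q) = q.
Proof. exact: reprK. Qed.

Lemma lpiB u v : lpi (u - v) = lpi u - lpi v.
Proof. exact: (raddfB \pi_(Quotient.quot (ssmem W))). Qed.

Lemma lpiD u v : lpi (u + v) = lpi u + lpi v.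
Proof. exact: (raddfD \pi_(Quotient.quot (ssmem W))). Qed.

(* Locked, like qbr below: otherwise unification may unfold an operation of   *)
(* the quotient to solve an equation of the form lpi ?v = _.                  *)
Definition lquot_scale (a : K) (q : lquot) : lquot :=
  locked (lpi (a *: repr q)).

Lemma lpiZ a u : lpi (a *: u) = lquot_scale a (lpi u).
Proof.
rewrite /lquot_scale -lock; apply/lpi_eq.
by rewrite -scalerBr rpredZ //; apply/lpi_eq; rewrite lpi_surj.
Qed.

Fact lquot_scaleA a b q :
  lquot_scale a (lquot_scale b q) = lquot_scale (a * b) q.
Proof. by rewrite -(lpi_surj q) -!lpiZ scalerA. Qed.
Fact lquot_scale1 : left_id 1 lquot_scale.
Proof. by move=> q; rewrite -(lpi_surj q) -lpiZ scale1r. Qed.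
Fact lquot_scaleDr : right_distributive lquot_scale +%R.
Proof.
by move=> a p q; rewrite -(lpi_surj p) -(lpi_surj q) -lpiD -!lpiZ scalerDr lpiD.
Qed.
Fact lquot_scaleDl q : {morph lquot_scale^~ q : a b / a + b}.
Proof. by move=> a b; rewrite -(lpi_surj q) -!lpiZ scalerDl lpiD. Qed.

HB.instance Definition _ := GRing.Zmodule_isLmodule.Build K lquot
  lquot_scaleA lquot_scale1 lquot_scaleDr lquot_scaleDl.

Fact lpi_linear : linear lpi.
Proof. by move=> a u v; rewrite lpiD lpiZ. Qed.
HB.instance Definition _ := GRing.isLinear.Build K V lquot *:%R lpi lpi_linear.

Lemma lpi_scale a u : lpi (a *: u) = a *: lpi u.
Proof. exact: lpiZ. Qed.

End QuotientSpace.

Section Subquotient.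
Variables (K : fieldType) (V : lmodType K) (Z B : subspace V).

Definition subsp : Type := {v : V | v \in Z}.
HB.instance Definition _ := SubType.on subsp.
HB.instance Definition _ := Choice.on subsp.
HB.instance Definition _ := [SubChoice_isSubLmodule of subsp by <:].

Definition subsp_mem : {pred subsp} := [pred z : subsp | val z \in B].
Fact subsp_mem_closed : submod_closed subsp_mem.
Proof.
split=> [|a u v]; rewrite !inE; first by rewrite raddf0 rpred0.
by move=> hu hv; rewrite linearP rpredD ?rpredZ.
Qed.
Definition subquot := lquot (Subspace subsp_mem_closed).
HB.instance Definition _ := GRing.Lmodule.on subquot.
End Subquotient.

HB.mixin Record Lmodule_isSuperalg (K : fieldType) V of GRing.Lmodule K V := {
  spart : bool -> {pred V};
  sbr : V -> V -> V;
  spart_closed : forall b, submod_closed (spart b);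
  spart_sum : forall v, exists2 u, u \in spart false & v - u \in spart true;
  spart_disj : forall v, v \in spart false -> v \in spart true -> v = 0;
  sbr_linearl : forall v, linear (sbr^~ v);
  sbr_linearr : forall u, linear (sbr u);
  spart_br : forall a b u v,
    u \in spart a -> v \in spart b -> sbr u v \in spart (a (+) b)
}.

#[short(type="superalgType")]
HB.structure Definition Superalg (K : fieldType) :=
  {V of GRing.Lmodule K V & Lmodule_isSuperalg K V}.

Notation "[< x , y >]" := (sbr x y)
  (at level 0, x, y at level 99, format "[<  x ,  y  >]") : ring_scope.

Section SuperalgTheory.
Variables (K : fieldType) (F : superalgType K).
Implicit Types (u v w : F) (a b : bool).

HB.instance Definition _ b :=
  GRing.isSubmodClosed.Build K F (spart b) (spart_closed b).
HB.instance Definition _ u :=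
  GRing.isLinear.Build K F F *:%R (sbr u) (sbr_linearr u).

Lemma sbrDl u v w : [< u + v, w >] = [< u, w >] + [< v, w >].
Proof. by have := sbr_linearl w 1 u v; rewrite !scale1r. Qed.
Lemma sbrDr u v w : [< w, u + v >] = [< w, u >] + [< w, v >].
Proof. exact: raddfD. Qed.
Lemma sbr0l w : [< 0, w >] = 0.
Proof. by apply: (addrI [< 0, w >]); rewrite -sbrDl !addr0. Qed.
Lemma sbrZl c u w : [< c *: u, w >] = c *: [< u, w >].
Proof. by have := sbr_linearl w c u 0; rewrite sbr0l !addr0. Qed.
Lemma sbrZr c u w : [< w, c *: u >] = c *: [< w, u >].
Proof. exact: linearZ. Qed.
Lemma sbrBl u v w : [< u - v, w >] = [< u, w >] - [< v, w >].
Proof. by rewrite sbrDl -!scaleN1r sbrZl. Qed.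
Lemma sbrBr u v w : [< w, u - v >] = [< w, u >] - [< w, v >].
Proof. exact: raddfB. Qed.

Lemma spart_decomp v :
  exists u0 u1, [/\ u0 \in spart false, u1 \in spart true & v = u0 + u1].
Proof.
have [u u0 u1] := spart_sum v.
by exists u, (v - u); split=> //; rewrite addrC subrK.
Qed.

End SuperalgTheory.

HB.mixin Record Superalg_isLie (K : fieldType) L of Superalg K L := {
  sbr_anti : forall a b (u v : L), u \in spart a -> v \in spart b ->
    [< u, v >] = - ((-1) ^+ (a && b) *: [< v, u >]);
  sbr_jacobi : forall a b (u v w : L), u \in spart a -> v \in spart b ->
    [< u, [< v, w >] >] =
      [< [< u, v >], w >] + (-1) ^+ (a && b) *: [< v, [< u, w >] >];
  sbr_cube : forall u : L, u \in spart true -> [< u, [< u, u >] >] = 0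
}.

(* sbr_cube follows from sbr_jacobi when 3 is invertible in K. These are not  *)
(* the axioms of a Lie superalgebra in characteristic 2.                      *)
#[short(type="lieSuperType")]
HB.structure Definition LieSuper (K : fieldType) :=
  {L of Superalg K L & Superalg_isLie K L}.

Definition absorbing (K : fieldType) (F : superalgType K) (I : {pred F}) :=
  submod_closed I /\
  forall u v, v \in I -> [< u, v >] \in I /\ [< v, u >] \in I.

Record superideal (K : fieldType) (F : superalgType K) := Superideal {
  siss :> subspace F;
  si_absorbing : absorbing siss;
  si_graded : forall v, v \in siss ->
    exists u0 u1, [/\ u0 \in siss, u1 \in siss,
      u0 \in spart false, u1 \in spart true & v = u0 + u1]
}.

Section QuotientSuperalg.
Variables (K : fieldType) (F : superalgType K) (I : superideal F).
Local Notation Q := (lquot I).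

Definition qpart (b : bool) : {pred Q} :=
  [pred q | `[< exists2 u, u \in spart b & q = lpi I u >]].

Lemma qpartP b q :
  reflect (exists2 u, u \in spart b & q = lpi I u) (q \in qpart b).
Proof. by rewrite inE; apply: asboolP. Qed.

Definition qbr (p q : Q) : Q := locked (lpi I [< repr p, repr q >]).

Lemma lpi_br u v : lpi I [< u, v >] = qbr (lpi I u) (lpi I v).
Proof.
rewrite /qbr -lock; apply/lpi_eq; have [_ abs] := si_absorbing I.
have hu : u - repr (lpi I u) \in I by apply/lpi_eq; rewrite lpi_surj.
have hv : v - repr (lpi I v) \in I by apply/lpi_eq; rewrite lpi_surj.
rewrite -(subrKA [< repr (lpi I u), v >]) -sbrBl -sbrBr rpredD //.
  by have [] := abs v _ hu.
by have [] := abs (repr (lpi I u)) _ hv.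
Qed.

Fact qpart_closed b : submod_closed (qpart b).
Proof.
split; first by apply/qpartP; exists 0; rewrite ?raddf0 ?rpred0.
move=> c p q /qpartP[u hu ->] /qpartP[v hv ->]; apply/qpartP.
by exists (c *: u + v); rewrite ?linearP // rpredD ?rpredZ.
Qed.

Fact qpart_sum q : exists2 p, p \in qpart false & q - p \in qpart true.
Proof.
have [u0 [u1 [h0 h1 e]]] := spart_decomp (repr q).
exists (lpi I u0); apply/qpartP; first by exists u0.
by exists u1 => //; rewrite -(lpi_surj q) e raddfD /= addrAC subrr add0r.
Qed.

Fact qpart_disj q : q \in qpart false -> q \in qpart true -> q = 0.
Proof.
move=> /qpartP[u hu ->] /qpartP[v hv /lpi_eq /si_graded[w0 [w1]]].
case=> [I0 I1 h0 h1 e].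
have uw : u = w0.
  apply/eqP; rewrite -subr_eq0; apply/eqP/spart_disj; first exact: rpredB.
  suff -> : u - w0 = v + w1 by rewrite rpredD.
  by rewrite -[u](subrK v) e addrC !addrA addNr add0r addrC.
by rewrite -(raddf0 (lpi I)); apply/lpi_eq; rewrite subr0 uw.
Qed.

Fact qbr_linearl q : linear (qbr^~ q).
Proof.
move=> c u v; rewrite -(lpi_surj u) -(lpi_surj v) -(lpi_surj q).
by rewrite -linearP -!lpi_br -linearP sbrDl sbrZl.
Qed.

Fact qbr_linearr q : linear (qbr q).
Proof.
move=> c u v; rewrite -(lpi_surj u) -(lpi_surj v) -(lpi_surj q).
by rewrite -linearP -!lpi_br -linearP sbrDr sbrZr.
Qed.

Fact qpart_br a b p q :
  p \in qpart a -> q \in qpart b -> qbr p q \in qpart (a (+) b).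
Proof.
move=> /qpartP[u hu ->] /qpartP[v hv ->]; apply/qpartP.
by exists [< u, v >]; rewrite ?lpi_br // spart_br.
Qed.

HB.instance Definition _ := Lmodule_isSuperalg.Build K Q
  qpart_closed qpart_sum qpart_disj qbr_linearl qbr_linearr qpart_br.

Lemma lpi_sbr (u v : F) : lpi I [< u, v >] = [< lpi I u, lpi I v >].
Proof. exact: lpi_br. Qed.

End QuotientSuperalg.

Section QuotientLie.
Variables (K : fieldType) (L : lieSuperType K) (I : superideal L).
Local Notation Q := (lquot I).

Fact qlie_anti a b (p q : Q) : p \in spart a -> q \in spart b ->
  [< p, q >] = - ((-1) ^+ (a && b) *: [< q, p >]).
Proof.
move=> /qpartP[u hu ->] /qpartP[v hv ->].
by rewrite -!lpi_sbr (sbr_anti _ _ _ _ hu hv) raddfN /= linearZ.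
Qed.

Fact qlie_jacobi a b (p q r : Q) : p \in spart a -> q \in spart b ->
  [< p, [< q, r >] >] =
    [< [< p, q >], r >] + (-1) ^+ (a && b) *: [< q, [< p, r >] >].
Proof.
move=> /qpartP[u hu ->] /qpartP[v hv ->]; rewrite -(lpi_surj r).
by rewrite -!lpi_sbr (sbr_jacobi _ _ _ _ _ hu hv) raddfD /= linearZ.
Qed.

Fact qlie_cube (q : Q) : q \in spart true -> [< q, [< q, q >] >] = 0.
Proof.
by move=> /qpartP[u hu ->]; rewrite -!lpi_sbr sbr_cube // raddf0.
Qed.

HB.instance Definition _ :=
  Superalg_isLie.Build K Q qlie_anti qlie_jacobi qlie_cube.

End QuotientLie.

Section GeneratedIdeal.
Variables (K : fieldType) (F : superalgType K) (R : F -> Prop).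

Definition gen_ideal : {pred F} :=
  [pred v | `[< forall I : {pred F}, absorbing I ->
                  (forall r, R r -> r \in I) -> v \in I >]].

Lemma gen_idealP v :
  (forall I : {pred F}, absorbing I -> (forall r, R r -> r \in I) -> v \in I)
  <-> v \in gen_ideal.
Proof. by rewrite inE; split=> /asboolP. Qed.

Lemma gen_ideal_sub r : R r -> r \in gen_ideal.
Proof. by move=> Rr; apply/gen_idealP=> I _; apply. Qed.

Fact gen_ideal_closed : submod_closed gen_ideal.
Proof.
split; first by apply/gen_idealP=> I [[]].
move=> c u v /gen_idealP hu /gen_idealP hv; apply/gen_idealP=> I hI hR.
by have [[_ ->]] := hI; [|apply: hu|apply: hv].
Qed.

Fact gen_ideal_absorbing : absorbing gen_ideal.
Proof.
split; first exact: gen_ideal_closed.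
by move=> u v /gen_idealP hv; split; apply/gen_idealP=> I hI hR;
   have [_ /(_ u v (hv I hI hR)) []] := hI.
Qed.

Definition gen_subspace : subspace F := Subspace gen_ideal_closed.

Definition bigraded (I : {pred F}) : {pred F} :=
  [pred v | `[< exists u0 u1, [/\ u0 \in I, u1 \in I,
      u0 \in spart false, u1 \in spart true & v = u0 + u1] >]].

Lemma bigraded_closed (I : subspace F) : submod_closed (bigraded I).
Proof.
split; first by rewrite inE; apply/asboolP; exists 0, 0;
  split; rewrite ?rpred0 ?addr0.
move=> c u v; rewrite !inE.
move=> /asboolP[u0 [u1 [? ? ? ? ->]]] /asboolP[v0 [v1 [? ? ? ? ->]]].
apply/asboolP; exists (c *: u0 + v0), (c *: u1 + v1).
by split; rewrite ?rpredD ?rpredZ // scalerDr addrACA.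
Qed.

Lemma bigraded_absorbing (I : subspace F) : absorbing I -> absorbing (bigraded I).
Proof.
move=> [_ abs]; split; first exact: bigraded_closed.
move=> u v; rewrite !inE => /asboolP[v0 [v1 [I0 I1 h0 h1 ->]]].
have [u0 [u1 [g0 g1 ->]]] := spart_decomp u.
have [[? ?] [? ?]] := (abs u0 _ I0, abs u0 _ I1).
have [[? ?] [? ?]] := (abs u1 _ I0, abs u1 _ I1).
split; apply/asboolP.
  exists ([< u0, v0 >] + [< u1, v1 >]), ([< u0, v1 >] + [< u1, v0 >]).
  split; try exact: rpredD.
  - by apply: rpredD; [apply: (spart_br false false)|apply: (spart_br true true)].
  - by apply: rpredD; [apply: (spart_br false true)|apply: (spart_br true false)].
  by rewrite sbrDl !sbrDr [X in _ + X]addrC addrACA.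
exists ([< v0, u0 >] + [< v1, u1 >]), ([< v0, u1 >] + [< v1, u0 >]).
split; try exact: rpredD.
- by apply: rpredD; [apply: (spart_br false false)|apply: (spart_br true true)].
- by apply: rpredD; [apply: (spart_br false true)|apply: (spart_br true false)].
by rewrite sbrDl !sbrDr [X in _ + X]addrC addrACA.
Qed.

Hypothesis R_homogeneous : forall r, R r -> exists b, r \in spart b.

Fact gen_ideal_graded v : v \in gen_subspace ->
  exists u0 u1, [/\ u0 \in gen_subspace, u1 \in gen_subspace,
    u0 \in spart false, u1 \in spart true & v = u0 + u1].
Proof.
move=> /gen_idealP hv.
have := hv _ (bigraded_absorbing (gen_ideal_absorbing : absorbing gen_subspace)).
suff h : forall r, R r -> r \in bigraded gen_subspace.
  by move=> /(_ h); rewrite inE => /asboolP.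
move=> r Rr; rewrite inE; apply/asboolP.
have Ir : r \in gen_subspace by apply: gen_ideal_sub.
by have [[] hr] := R_homogeneous Rr; [exists 0, r|exists r, 0];
   split; rewrite ?rpred0 ?addr0 ?add0r.
Qed.

Definition gen_superideal : superideal F :=
  @Superideal _ _ gen_subspace gen_ideal_absorbing gen_ideal_graded.

End GeneratedIdeal.

Inductive word (T : Type) := Letter of T | Node of word T & word T.
Arguments Letter {T}.

HB.instance Definition _ (T : Type) := gen_eqMixin (word T).
HB.instance Definition _ (T : Type) := gen_choiceMixin (word T).

Section Fglift.
Variables (K : fieldType) (T : choiceType) (V : lmodType K) (f : T -> V).

HB.instance Definition _ :=
  GRing.isZmodMorphism.Build {freeg T / K} V (fglift f) (lift_is_additive f).

Lemma fgliftE u : fglift f u = \sum_(w <- dom u) coeff w u *: f w.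
Proof.
by rewrite -{1}[u]freeg_sumE raddf_sum; apply: eq_bigr => w _; rewrite /= liftU.
Qed.

Lemma fglift_scalable : scalable (fglift f).
Proof.
move=> c u; rewrite [in RHS]fgliftE scaler_sumr raddf_sum.
by apply: eq_bigr => w _; rewrite /= liftU scalerA.
Qed.

HB.instance Definition _ :=
  GRing.isScalable.Build K {freeg T / K} V *:%R (fglift f) fglift_scalable.

End Fglift.

(* The free nonassociative superalgebra on the letters T; the parity p only   *)
(* selects the superspace structure.                                          *)
Definition free_superalg (K : fieldType) (T : Type) (p : T -> bool) : Type :=
  {freeg (word T) / K}.
HB.instance Definition _ K T p := GRing.Lmodule.on (@free_superalg K T p).

Section FreeSuperalg.
Variables (K : fieldType) (T : Type) (p : T -> bool).
Local Notation F := (free_superalg K p).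

Fixpoint wparity (w : word T) : bool :=
  match w with
  | Letter t => p t
  | Node w1 w2 => wparity w1 (+) wparity w2
  end.

Definition letter (t : T) : F := << Letter t >>.

Definition free_part (b : bool) : {pred F} :=
  [pred u : F | `[< forall w, coeff w u != 0 -> wparity w = b >]].

Definition free_br (u v : F) : F :=
  fglift (fun w1 => fglift (fun w2 => << Node w1 w2 >> : F) v) u.

Lemma free_partP b u :
  reflect (forall w, coeff w u != 0 -> wparity w = b) (u \in free_part b).
Proof. by rewrite inE; apply: asboolP. Qed.

Fact free_part_closed b : submod_closed (free_part b).
Proof.
split; first by apply/free_partP=> w; rewrite coeff0 eqxx.
move=> c u v /free_partP hu /free_partP hv; apply/free_partP=> w.
rewrite coeffD coeffZ; have [->|/hu //] := eqVneq (coeff w u) 0.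
by rewrite mulr0 add0r => /hv.
Qed.

HB.instance Definition _ b :=
  GRing.isSubmodClosed.Build K F (free_part b) (free_part_closed b).

Lemma free_part_word c w : << c *g w >> \in free_part (wparity w).
Proof.
apply/free_partP=> w'; rewrite coeffU.
by have [->//|_] := eqVneq w w'; rewrite mulr0 eqxx.
Qed.

Fact free_part_sum u :
  exists2 u0, u0 \in free_part false & u - u0 \in free_part true.
Proof.
exists (\sum_(w <- dom u | ~~ wparity w) << coeff w u *g w >>).
  by apply: rpred_sum => w /negPf <-; apply: free_part_word.
rewrite -{1}[u]freeg_sumE (bigID (fun w => ~~ wparity w)) /= addrC addrK.
by apply: rpred_sum => w; rewrite negbK => <-; apply: free_part_word.
Qed.

Fact free_part_disj u : u \in free_part false -> u \in free_part true -> u = 0.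
Proof.
move=> /free_partP h0 /free_partP h1; apply/eqP/freeg_eqP=> w.
rewrite coeff0; apply/eqP/negPn/negP => hw.
by have := h0 _ hw; rewrite h1.
Qed.

Fact free_br_linearl v : linear (free_br^~ v).
Proof. exact: linearP. Qed.

Fact free_br_linearr u : linear (free_br u).
Proof.
move=> c v1 v2; rewrite /free_br !fgliftE scaler_sumr -big_split /=.
apply: eq_bigr => w _; rewrite linearP scalerDr !scalerA.
by rewrite mulrC.
Qed.

Fact free_part_br a b u v :
  u \in free_part a -> v \in free_part b -> free_br u v \in free_part (a (+) b).
Proof.
move=> /free_partP hu /free_partP hv; rewrite /free_br fgliftE big_seq.
apply: rpred_sum => w1; rewrite mem_dom => /hu <-; apply: rpredZ.
rewrite fgliftE big_seq.
apply: rpred_sum => w2; rewrite mem_dom => /hv <-; apply: rpredZ.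
exact: (free_part_word 1 (Node w1 w2)).
Qed.

HB.instance Definition _ := Lmodule_isSuperalg.Build K F
  free_part_closed free_part_sum free_part_disj
  free_br_linearl free_br_linearr free_part_br.

End FreeSuperalg.

Inductive lie_relator (K : fieldType) (F : superalgType K) : F -> Prop :=
| RelAnti a b (u v : F) of u \in spart a & v \in spart b :
    lie_relator ([< u, v >] + (-1) ^+ (a && b) *: [< v, u >])
| RelJacobi a b c (u v w : F) of
    u \in spart a & v \in spart b & w \in spart c :
    lie_relator ([< u, [< v, w >] >] -
      ([< [< u, v >], w >] + (-1) ^+ (a && b) *: [< v, [< u, w >] >]))
| RelCube (u : F) of u \in spart true :
    lie_relator [< u, [< u, u >] >].

Inductive chevalley (n : nat) := GenX of 'I_n | GenY of 'I_n | GenH of 'I_n.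
Arguments GenX {n}.
Arguments GenY {n}.
Arguments GenH {n}.

Section CartanMatrix.
Variables (K : fieldType) (n : nat) (A : 'M[K]_n) (p : 'I_n -> bool).

Definition chevalley_parity (g : chevalley n) : bool :=
  match g with GenX i | GenY i => p i | GenH _ => false end.

Definition chevalley_degree (g : chevalley n) : 'rV[int]_n :=
  match g with
  | GenX i => delta_mx 0 i
  | GenY i => - delta_mx 0 i
  | GenH _ => 0
  end.

Fixpoint word_degree (w : word (chevalley n)) : 'rV[int]_n :=
  match w with
  | Letter g => chevalley_degree g
  | Node w1 w2 => word_degree w1 + word_degree w2
  end.

Let F := free_superalg K chevalley_parity.
Let X i : F := letter K chevalley_parity (GenX i).
Let Y i : F := letter K chevalley_parity (GenY i).
Let H i : F := letter K chevalley_parity (GenH i).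

Inductive cartan_relator : F -> Prop :=
| RelLie u of lie_relator u : cartan_relator u
| RelHH i j : cartan_relator [< H i, H j >]
| RelHX i j : cartan_relator ([< H i, X j >] - A i j *: X j)
| RelHY i j : cartan_relator ([< H i, Y j >] + A i j *: Y j)
| RelXY i j : cartan_relator ([< X i, Y j >] - H i *+ (i == j)).

Lemma letter_part t : letter K chevalley_parity t \in spart (chevalley_parity t).
Proof. exact: (free_part_word _ 1 (Letter t)). Qed.

Fact lie_relator_homogeneous (L : superalgType K) (r : L) :
  lie_relator r -> exists b, r \in spart b.
Proof.
case=> [a b u v hu hv|a b c u v w hu hv hw|u hu].
- exists (a (+) b); apply: rpredD; first exact: spart_br.
  by apply: rpredZ; rewrite addbC; apply: spart_br.
- exists (a (+) b (+) c); apply: rpredB; last (apply: rpredD; last apply: rpredZ).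
  + by rewrite -addbA; do 2?apply: spart_br.
  + by do 2?apply: spart_br.
  by rewrite (addbC a) -addbA; do 2?apply: spart_br.
by exists (true (+) (true (+) true)); do 2?apply: spart_br.
Qed.

Fact cartan_relator_homogeneous r :
  cartan_relator r -> exists b, r \in spart b.
Proof.
case=> [u /lie_relator_homogeneous //|i j|i j|i j|i j].
- by exists (false (+) false); apply: spart_br; apply: letter_part.
- exists (false (+) p j); apply: rpredB.
    by apply: spart_br; apply: letter_part.
  by apply: rpredZ; apply: letter_part.
- exists (false (+) p j); apply: rpredD.
    by apply: spart_br; apply: letter_part.
  by apply: rpredZ; apply: letter_part.
exists (p i (+) p j); apply: rpredB.
  by apply: spart_br; apply: letter_part.
have [->|_] := eqVneq i j; last by rewrite mulr0n rpred0.
by rewrite addbb; apply: rpredMn; apply: (letter_part (GenH _)).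
Qed.

Definition cartan_ideal : superideal F :=
  gen_superideal cartan_relator_homogeneous.

Let Q := lquot cartan_ideal.

Fact cartan_relation r : cartan_relator r -> lpi cartan_ideal r = 0.
Proof.
move=> Rr; rewrite -(raddf0 (lpi cartan_ideal)); apply/lpi_eq.
by rewrite subr0; apply: gen_ideal_sub.
Qed.

Fact gtilde_anti a b (u v : Q) : u \in spart a -> v \in spart b ->
  [< u, v >] = - ((-1) ^+ (a && b) *: [< v, u >]).
Proof.
move=> /qpartP[u' hu ->] /qpartP[v' hv ->]; apply/eqP; rewrite -addr_eq0.
by rewrite -!lpi_sbr -lpi_scale -lpiD cartan_relation //; apply: RelLie; apply: RelAnti.
Qed.

Fact gtilde_jacobi a b (u v w : Q) : u \in spart a -> v \in spart b ->
  [< u, [< v, w >] >] =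
    [< [< u, v >], w >] + (-1) ^+ (a && b) *: [< v, [< u, w >] >].
Proof.
move=> /qpartP[u' hu ->] /qpartP[v' hv ->].
suff hom c w' : w' \in spart c -> let w := lpi cartan_ideal w' in
   [< lpi _ u', [< lpi _ v', w >] >] = [< [< lpi _ u', lpi _ v' >], w >]
     + (-1) ^+ (a && b) *: [< lpi _ v', [< lpi _ u', w >] >].
  have [w0 [w1 [/hom /= h0 /hom /= h1 e]]] := spart_decomp (repr w).
  rewrite -(lpi_surj w) e raddfD /= !sbrDr h0 h1 scalerDr.
  exact: addrACA.
move=> hw /=; apply/eqP; rewrite -subr_eq0.
rewrite -!lpi_sbr -lpi_scale -lpiD -lpiB cartan_relation //.
by apply: RelLie; apply: (RelJacobi hu hv hw).
Qed.

Fact gtilde_cube (u : Q) : u \in spart true -> [< u, [< u, u >] >] = 0.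
Proof.
move=> /qpartP[u' hu ->].
by rewrite -!lpi_sbr cartan_relation //; apply: RelLie; apply: RelCube.
Qed.

Definition gtilde : Type := Q.
HB.instance Definition _ := Superalg.on gtilde.
HB.instance Definition _ :=
  Superalg_isLie.Build K gtilde gtilde_anti gtilde_jacobi gtilde_cube.

Definition tgen (t : chevalley n) : gtilde :=
  lpi cartan_ideal (letter K chevalley_parity t).

Definition has_degree (d : 'rV[int]_n) (v : gtilde) : Prop :=
  exists2 u : F, (forall w, coeff w u != 0 -> word_degree w = d)
               & v = lpi cartan_ideal u.

Definition zgraded (I : {pred gtilde}) : Prop :=
  forall v, v \in I -> exists s : seq gtilde,
    (forall u, u \in s -> u \in I /\ exists d, has_degree d u) /\
    v = \sum_(u <- s) u.

Definition in_cartan (v : gtilde) : Prop :=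
  exists c : 'I_n -> K, v = \sum_i c i *: tgen (GenH i).

Definition avoids_cartan (I : {pred gtilde}) : Prop :=
  [/\ absorbing I, zgraded I & forall v, v \in I -> in_cartan v -> v = 0].

(* The sum of all graded ideals meeting the span of the h_i trivially. As the *)
(* component of degree 0 of gtilde is this span, the sum also meets it        *)
(* trivially, and so it is the largest such ideal.                            *)
Definition max_ideal : {pred gtilde} :=
  [pred v | `[< forall W : {pred gtilde}, submod_closed W ->
     (forall I, avoids_cartan I -> {subset I <= W}) -> v \in W >]].

Lemma max_idealP v :
  (forall W : {pred gtilde}, submod_closed W ->
     (forall I, avoids_cartan I -> {subset I <= W}) -> v \in W)
  <-> v \in max_ideal.
Proof. by rewrite inE; split=> /asboolP. Qed.

Lemma max_ideal_sub I : avoids_cartan I -> {subset I <= max_ideal}.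
Proof. by move=> hI v Iv; apply/max_idealP=> W _ hW; apply: hW hI v Iv. Qed.

Fact max_ideal_closed : submod_closed max_ideal.
Proof.
split; first by apply/max_idealP=> W [].
move=> c u v /max_idealP hu /max_idealP hv; apply/max_idealP=> W hW hI.
by have [_ ->] := hW; [|apply: hu|apply: hv].
Qed.

Definition max_subspace : subspace gtilde := Subspace max_ideal_closed.

Fact max_ideal_absorbing : absorbing max_ideal.
Proof.
split; first exact: max_ideal_closed.
move=> u v /max_idealP hv.
pose W : {pred gtilde} :=
  [pred w | ([< u, w >] \in max_subspace) && ([< w, u >] \in max_subspace)].
suff : v \in W by move/andP.
apply: hv; first split.
- by apply/andP; rewrite raddf0 sbr0l; split; apply: rpred0.
- move=> c w1 w2 /andP[h1 h1'] /andP[h2 h2']; apply/andP.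
  by rewrite linearP sbrDl sbrZl; split; apply: rpredD => //; apply: rpredZ.
move=> I hI w Iw; have [[_ abs] _ _] := hI.
by have [? ?] := abs u w Iw; apply/andP; split; apply: (max_ideal_sub hI).
Qed.

Definition degree_parity (d : 'rV[int]_n) : bool :=
  odd `|\sum_i d 0 i *+ p i|.

Fact degree_parityD d1 d2 :
  degree_parity (d1 + d2) = degree_parity d1 (+) degree_parity d2.
Proof.
rewrite /degree_parity.
under eq_bigr do rewrite mxE mulrnDl.
rewrite big_split /=; move: (\sum_i _) (\sum_i _) => x y; lia.
Qed.

Fact degree_parityN d : degree_parity (- d) = degree_parity d.
Proof.
rewrite /degree_parity.
under eq_bigr do rewrite mxE mulNrn.
by rewrite sumrN abszN.
Qed.

Fact degree_parity_delta i : degree_parity (delta_mx 0 i) = p i.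
Proof.
rewrite /degree_parity (bigD1 i) //= big1 ?addr0 => [|j /negPf ji].
  by rewrite mxE !eqxx; case: (p i).
by rewrite mxE ji andbF mul0rn.
Qed.

Fact degree_parity0 : degree_parity 0 = false.
Proof. by rewrite /degree_parity big1 // => i _; rewrite mxE mul0rn. Qed.

Fact word_degree_parity w :
  wparity chevalley_parity w = degree_parity (word_degree w).
Proof.
elim: w => [[i|i|i]|w1 h1 w2 h2] /=.
- by rewrite degree_parity_delta.
- by rewrite degree_parityN degree_parity_delta.
- by rewrite degree_parity0.
by rewrite degree_parityD h1 h2.
Qed.

Fact has_degree_part d v : has_degree d v -> v \in spart (degree_parity d).
Proof.
case=> u hu ->; apply/qpartP; exists u => //; apply/free_partP=> w /hu <-.
exact: word_degree_parity.
Qed.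

Fact max_ideal_graded v : v \in max_subspace ->
  exists u0 u1, [/\ u0 \in max_subspace, u1 \in max_subspace,
    u0 \in spart false, u1 \in spart true & v = u0 + u1].
Proof.
move=> /max_idealP hv.
suff : v \in bigraded max_subspace by rewrite inE => /asboolP.
apply: hv; first exact: bigraded_closed.
move=> I hI w Iw; have [_ /(_ w Iw)[s [hs ->]] _] := hI.
pose B := Subspace (bigraded_closed max_subspace).
rewrite big_seq; apply: (rpred_sum (S := B)) => u /hs[Iu [d /has_degree_part hu]].
have hI' := max_ideal_sub hI Iu.
rewrite inE; apply/asboolP.
by case: (degree_parity d) hu => hu; [exists 0, u|exists u, 0];
   split; rewrite ?rpred0 ?addr0 ?add0r.
Qed.

Definition max_superideal : superideal gtilde :=
  @Superideal _ _ max_subspace max_ideal_absorbing max_ideal_graded.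

Definition cartan_superalg : Type := lquot max_superideal.
HB.instance Definition _ := LieSuper.on cartan_superalg.

Definition cgen (t : chevalley n) : cartan_superalg :=
  lpi max_superideal (tgen t).

End CartanMatrix.

Lemma fct_linE (K : fieldType) (T : Type) (V : lmodType K) (c : K)
  (f1 f2 : T -> V) x : (c *: f1 + f2) x = c *: f1 x + f2 x.
Proof. by []. Qed.

Lemma fct_0E (T : Type) (V : zmodType) x : (0 : T -> V) x = 0.
Proof. by []. Qed.

Section Cohomology.
Variables (K : fieldType) (g : lieSuperType K).

Definition is_derivation (b : bool) (D : g -> g) : Prop :=
  [/\ linear D,
      forall a x, x \in spart a -> D x \in spart (b (+) a)
    & forall a x y, x \in spart a ->
        D [< x, y >] = [< D x, y >] + (-1) ^+ (b && a) *: [< x, D y >]].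

Definition derivation : {pred (g -> g)} :=
  [pred D | `[< exists D0 D1 : g -> g, [/\ is_derivation false D0,
                  is_derivation true D1 & D = D0 + D1] >]].

Definition inner_derivation : {pred (g -> g)} :=
  [pred D | `[< exists u : g, D = sbr u >]].

Definition is_bilinear (om : g -> g -> K^o) : Prop :=
  (forall y, linear (om^~ y)) /\ (forall x, linear (om x)).

Definition cocycle2 : {pred (g -> g -> K^o)} :=
  [pred om | `[< [/\ is_bilinear om,
    forall a b x y, x \in spart a -> y \in spart b ->
      om x y = - ((-1) ^+ (a && b) * om y x),
    forall a b x y z, x \in spart a -> y \in spart b ->
      om [< x, y >] z = om x [< y, z >] - (-1) ^+ (a && b) * om y [< x, z >]
  & forall x, x \in spart true -> om x [< x, x >] = 0] >]].

Definition coboundary2 : {pred (g -> g -> K^o)} :=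
  [pred om | `[< exists2 f : g -> K^o, linear f &
                 om = fun x y => f [< x, y >] >]].

Fact is_derivation_lin b c D1 D2 :
  is_derivation b D1 -> is_derivation b D2 -> is_derivation b (c *: D1 + D2).
Proof.
move=> [l1 p1 d1] [l2 p2 d2]; split.
- move=> e x y; rewrite !(fct_linE, fct_0E) l1 l2 !scalerDr !scalerA mulrC.
  by rewrite addrACA.
- move=> a x hx; rewrite !(fct_linE, fct_0E).
  by apply: rpredD; [apply: rpredZ; apply: p1|apply: p2].
move=> a x y hx; rewrite !(fct_linE, fct_0E) (d1 _ _ _ hx) (d2 _ _ _ hx).
rewrite sbrDl sbrDr sbrZl sbrZr !scalerDr !scalerA mulrC.
by rewrite addrACA.
Qed.

Fact is_derivation0 b : is_derivation b (0 : g -> g).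
Proof.
split=> [c x y|a x hx|a x y hx]; rewrite !(fct_linE, fct_0E).
- by rewrite scaler0 addr0.
- exact: rpred0.
by rewrite sbr0l raddf0 scaler0 addr0.
Qed.

Fact derivation_closed : submod_closed derivation.
Proof.
split; first by rewrite inE; apply/asboolP; exists 0, 0;
  split; rewrite ?addr0 //; apply: is_derivation0.
move=> c u v; rewrite !inE => /asboolP[u0 [u1 [? ? ->]]].
move=> /asboolP[v0 [v1 [? ? ->]]]; apply/asboolP.
exists (c *: u0 + v0), (c *: u1 + v1).
by split; [apply: is_derivation_lin..|rewrite scalerDr addrACA].
Qed.

Fact inner_derivation_closed : submod_closed inner_derivation.
Proof.
split.
  rewrite inE; apply/asboolP; exists 0; apply/funext=> x.
  by rewrite sbr0l.
move=> c u v; rewrite !inE => /asboolP[u0 ->] /asboolP[v0 ->]; apply/asboolP.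
by exists (c *: u0 + v0); apply/funext=> x; rewrite sbrDl sbrZl.
Qed.

Fact cocycle2_closed : submod_closed cocycle2.
Proof.
split.
  rewrite inE; apply/asboolP; split.
  - by split=> ? ? ? ?; rewrite !(fct_linE, fct_0E) scaler0 addr0.
  - by move=> *; rewrite !(fct_linE, fct_0E) mulr0 oppr0.
  - by move=> *; rewrite !(fct_linE, fct_0E) mulr0 subr0.
  by [].
move=> c u v; rewrite !inE => /asboolP[[ul ur] ua uc ux].
move=> /asboolP[[vl vr] va vc vx]; apply/asboolP; split.
- split=> z e x y; rewrite !(fct_linE, fct_0E) ?ul ?vl ?ur ?vr !scalerDr !scalerA mulrC;
  by rewrite addrACA.
- move=> a b x y hx hy; rewrite !(fct_linE, fct_0E) (ua _ _ _ _ hx hy) (va _ _ _ _ hx hy).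
  by rewrite /GRing.scale /=; ring.
- move=> a b x y z hx hy; rewrite !(fct_linE, fct_0E).
  rewrite (uc _ _ _ _ _ hx hy) (vc _ _ _ _ _ hx hy).
  by rewrite /GRing.scale /=; ring.
by move=> x hx; rewrite !(fct_linE, fct_0E) (ux _ hx) (vx _ hx) scaler0 addr0.
Qed.

Fact coboundary2_closed : submod_closed coboundary2.
Proof.
split.
  rewrite inE; apply/asboolP; exists (fun=> 0) => //.
  by move=> ? ? ?; rewrite scaler0 addr0.
move=> c u v; rewrite !inE => /asboolP[f fl ->] /asboolP[f' fl' ->].
apply/asboolP; exists (c *: f + f') => // e x y.
by rewrite !(fct_linE, fct_0E) fl fl' !scalerDr !scalerA mulrC addrACA.
Qed.

Definition der : Type := subsp (Subspace derivation_closed).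
HB.instance Definition _ := GRing.Lmodule.on der.

Definition H1 : Type :=
  subquot (Subspace derivation_closed) (Subspace inner_derivation_closed).
HB.instance Definition _ := GRing.Lmodule.on H1.

Definition H1_class (D : der) : H1 := lpi _ D.

Definition H2 : Type :=
  subquot (Subspace cocycle2_closed) (Subspace coboundary2_closed).
HB.instance Definition _ := GRing.Lmodule.on H2.

Definition is_automorphism (theta : g -> g) : Prop :=
  [/\ bijective theta, linear theta,
      forall a x, x \in spart a -> theta x \in spart a
    & forall x y, theta [< x, y >] = [< theta x, theta y >]].

End Cohomology.

Definition brj23_matrix (K : fieldType) : 'M[K]_2 :=
  \matrix_(i < 2, j < 2) (nth [::] [:: [:: 0; -1]; [:: -2; 1]] i)`_j.

Definition brj23 (K : fieldType) : lieSuperType K :=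
  cartan_superalg (brj23_matrix K) (fun=> true).

Definition brj23_words (K : fieldType) (a b : brj23 K) : seq (brj23 K) :=
  [:: a; b;
      [< a, b >];
      [< b, b >];
      [< b, [< a, b >] >];
      [< [< a, b >], [< b, b >] >];
      [< [< b, b >], [< b, [< a, b >] >] >];
      [< [< b, [< a, b >] >], [< b, [< a, b >] >] >]].

(* The indices run from 1 to 8 for x and y, and from 1 to 2 for h. *)
Definition brj23_x (K : fieldType) (k : nat) : brj23 K :=
  (brj23_words (cgen _ _ (GenX ord0)) (cgen _ _ (GenX ord_max)))`_k.-1.
Definition brj23_y (K : fieldType) (k : nat) : brj23 K :=
  (brj23_words (cgen _ _ (GenY ord0)) (cgen _ _ (GenY ord_max)))`_k.-1.
Definition brj23_h (K : fieldType) (k : nat) : brj23 K :=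
  [< brj23_x K k, brj23_y K k >].

(* Main.v *)
(* Reduction to finite linear algebra over F_3. A basis adapted to the root   *)
(* system gives an 18-dimensional model M with structure constants in F_3,    *)
(* and the Lie superalgebra axioms for M are a finite computation. By the     *)
(* universal property the Chevalley generators give a morphism from           *)
(* gtilde(A) onto M. Its kernel is graded and avoids the Cartan subalgebra.   *)
(* Conversely, let I be a graded ideal avoiding the Cartan subalgebra, and    *)
(* let u in I be homogeneous with nonzero image. Bracketing u with a lift of  *)
(* the opposite root vector gives an element of I of degree 0 with nonzero    *)
(* image. This is a contradiction, since the component of degree 0 of         *)
(* gtilde(A) is the Cartan subalgebra: every bracket of generators is a       *)
(* combination of right-normed ones in the x_i alone or in the y_i alone and  *)
(* of the h_i. Hence M is g(A). In M, the entries of a derivation (the values of a        *)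
(* 2-cocycle) satisfy linear equations over F_3, from which Gaussian          *)
(* elimination deduces that it is a combination of an inner derivation, D     *)
(* and theta D theta^-1 (that it is a coboundary).                            *)
From HB Require Import structures.
Require Import Defs.
From mathcomp Require Import all_boot all_algebra.
From mathcomp Require Import generic_quotient.
From mathcomp Require Import boolp functions freeg zify ring.

Set Implicit Arguments.
Unset Strict Implicit.
Unset Printing Implicit Defensive.

(** * Sparse linear forms with coefficients in F_3 *)

(** Once g is known by its multiplication table, both statements are finite linear algebra over F_3.
    A linear consequence that holds over F_3 remains valid over K, so no computation in K is needed
    ([entailsP]).

    Identification. [brj_table] makes an 18-dimensional space M a Lie superalgebra whose Chevalley
    generators satisfy the relations of gtilde(A); this gives a surjection [tmodel] from gtilde(A)
    to M. Its kernel is the largest graded ideal that meets the Cartan subalgebra trivially: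
    [ker_avoids] and [ideal_sub_ker] are the two inclusions. The second rests on the triangular
    decomposition ([degree0_cartan]) and on the pairing of each root vector of M with its opposite
    into a nonzero Cartan element ([opposite_ok]). Hence g has the table of M in the given basis
    ([brj_presentation]).

    Derivations. The element u of an inner derivation ad u can be read off from its values at h_1
    and h_2 and its diagonal entries at x_1 and x_2. The coefficients of D and of theta D theta^-1
    can be read off from the components x_2 to y_4 and y_2 to x_4, which vanish for every inner
    derivation. For an arbitrary derivation the same formulas define a candidate combination, and
    the elimination [der_ok] shows that the Leibniz equations force equality
    ([derivation_combination]). The same two components show that the two classes are independent
    ([outer_independent]).

    Cocycles. If a cocycle is the coboundary of f, then its values at (x_i, y_i) and at (h_j, e_k)
    determine f. For an arbitrary cocycle these values define a candidate f, and [coc_ok] shows that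
    its coboundary is the cocycle ([cocycle_coboundary]). *)

Inductive trit := T0 | TP | TM.

Definition tadd a b :=
  match a, b with
  | T0, c | c, T0 => c
  | TP, TP => TM
  | TM, TM => TP
  | _, _ => T0
  end.

Definition topp a := match a with T0 => T0 | TP => TM | TM => TP end.

Definition tmul a b :=
  match a with T0 => T0 | TP => b | TM => topp b end.

Definition tzero a := if a is T0 then true else false.

Fact trit_eqP : Equality.axiom (fun a b => tzero (tadd a (topp b))).
Proof. by case; case; constructor. Qed.
HB.instance Definition _ := hasDecEq.Build trit trit_eqP.

Definition tsign (b : bool) := if b then TM else TP.

Section SparseForm.
Variable I : eqType.

Definition sform := seq (I * trit).
Implicit Types (u v : sform) (k : I) (c : trit).

(** Entries that become zero are deleted, so that a zero form built up from the empty list is again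
    the empty list. This is why the checks below can test for zero with [nilp]. *)
Fixpoint sput k c u : sform :=
  match u with
  | [::] => if tzero c then [::] else [:: (k, c)]
  | (k', c') :: u' =>
      if k == k' then
        let s := tadd c c' in if tzero s then u' else (k', s) :: u'
      else (k', c') :: sput k c u'
  end.

Definition sadd c u v : sform :=
  foldr (fun p r => if tzero p.2 then r else sput p.1 (tmul c p.2) r) v u.

Fixpoint scoef u k : trit :=
  if u is (k', c) :: u' then if k' == k then tadd c (scoef u' k) else scoef u' k
  else T0.

(* The rows of B are paired with their pivots, where their coefficient is 1. *)
Definition reduce (B : seq (I * sform)) u : sform :=
  foldl (fun r p => let c := scoef r p.1 in
                    if tzero c then r else sadd (topp c) p.2 r) u B.

(** A nonzero element of F_3 is its own inverse, so multiplication by c normalizes the pivot to 1. A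
    new row contains none of the earlier pivots, and therefore one pass of [reduce] from left to
    right clears all pivots. *)
Definition insert (B : seq (I * sform)) u : seq (I * sform) :=
  match reduce B u with
  | [::] => B
  | ((k, c) :: _) as r => rcons B (k, sadd c r [::])
  end.

Definition echelon (E : seq sform) : seq (I * sform) := foldl insert [::] E.

Definition entails (E T : seq sform) : bool :=
  let B := echelon E in all (fun t => nilp (reduce B t)) T.

End SparseForm.

Definition smap (I J : eqType) (f : I -> sform J) (u : sform I) : sform J :=
  foldr (fun p r => sadd p.2 (f p.1) r) [::] u.


(** * The structure constants *)

(* Indices 0-7 stand for x_1, ..., x_8, indices 8-15 for y_1, ..., y_8, and   *)
(* indices 16, 17 for h_1, h_2. Entry (i, j) is the bracket [e_i, e_j].       *)
Definition brj_table : seq (seq (sform nat)) :=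
  let o := [::] in let p k := [:: (k, TP)] in let m k := [:: (k, TM)] in
  [::
   [:: o; p 2; o; p 4; o; o; p 7; o; p 16; o; p 9; o; m 11; o; o; p 14; o; m
     0];
   [:: p 2; p 3; p 4; o; p 5; m 6; o; o; o; p 17; m 8; p 9; m 10; p 12; m
     13; o; p 1; m 1];
   [:: o; m 4; o; p 5; o; m 7; o; o; p 1; m 0; [:: (16, TM); (17, TP)]; o; p
     9; m 11; o; m 13; p 2; p 2];
   [:: m 4; o; m 5; o; p 6; o; o; o; o; p 1; o; m 17; m 8; p 10; p 12; o; m
     3; p 3];
   [:: o; p 5; o; m 6; p 7; o; o; o; p 3; p 2; m 1; p 0; [:: (16, TM); (17,
     TM)]; p 9; m 11; m 12; m 4; o];
   [:: o; p 6; p 7; o; o; o; o; o; o; p 4; p 3; m 2; p 1; m 16; p 9; p 10;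
     o; m 5];
   [:: p 7; o; o; o; o; o; o; o; o; p 5; o; m 4; p 3; m 1; [:: (16, TP);
     (17, TM)]; p 8; p 6; p 6];
   [:: o; o; o; o; o; o; o; o; p 6; o; p 5; o; m 4; m 2; p 0; [:: (16, TM);
     (17, TM)]; p 7; o];
   [:: p 16; o; m 1; o; p 3; o; o; m 6; o; p 10; o; p 12; o; o; p 15; o; o;
     p 8];
   [:: o; p 17; p 0; m 1; p 2; m 4; p 5; o; p 10; p 11; p 12; o; p 13; m 14;
     o; o; m 9; p 9];
   [:: m 9; p 8; [:: (16, TP); (17, TM)]; o; p 1; m 3; o; m 5; o; m 12; o; p
     13; o; m 15; o; o; m 10; m 10];
   [:: o; m 9; o; p 17; m 0; p 2; p 4; o; m 12; o; m 13; o; p 14; o; o; o; p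
     11; m 11];
   [:: m 11; m 10; m 9; p 8; [:: (16, TM); (17, TM)]; m 1; p 3; p 4; o; p
     13; o; m 14; p 15; o; o; o; p 12; o];
   [:: o; m 12; p 11; m 10; m 9; p 16; p 1; p 2; o; p 14; p 15; o; o; o; o;
     o; o; p 13];
   [:: o; m 13; o; m 12; m 11; m 9; [:: (16, TP); (17, TM)]; m 0; p 15; o;
     o; o; o; o; o; o; m 14; m 14];
   [:: m 14; o; p 13; o; p 12; m 10; m 8; [:: (16, TP); (17, TP)]; o; o; o;
     o; o; o; o; o; m 15; o];
   [:: o; m 1; m 2; p 3; p 4; o; m 6; m 7; o; p 9; p 10; m 11; m 12; o; p
     14; p 15; o; o];
   [:: p 0; p 1; m 2; m 3; o; p 5; m 6; o; m 8; m 9; p 10; p 11; o; m 13; p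
     14; o; o; o]].

Definition tbl (i j : nat) : sform nat := nth [::] (nth [::] brj_table i) j.

Definition sconst (i j k : nat) : trit := scoef (tbl i j) k.

Definition odd_index (i : nat) : bool := nth false
  [:: true; true; false; false; true; false; true; false;
      true; true; false; false; true; false; true; false; false; false] i.

Definition tbll (i : nat) (u : sform nat) : sform nat := smap (tbl i) u.
Definition tblr (u : sform nat) (j : nat) : sform nat := smap (tbl^~ j) u.
Definition tbl2 (u v : sform nat) : sform nat := smap (tbll^~ v) u.

Definition all_index (a : nat -> bool) := all a (iota 0 18).

Lemma all_indexP (P : nat -> bool) : all_index P -> forall i, i < 18 -> P i.
Proof. by move=> /allP h i hi; apply: h; rewrite mem_iota. Qed.

Definition jacobi_check i j k :=
  nilp (sadd TM (tbll i (tbl j k)) (sadd TP (tblr (tbl i j) k)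
     (sadd (tsign (odd_index i && odd_index j)) (tbll j (tbl i k)) [::]))).

Lemma jacobi_ok :
  all_index (fun i => all_index (fun j => all_index (jacobi_check i j))).
Proof. by vm_compute. Qed.

Definition anti_check i j := nilp (sadd TP (tbl i j)
  (sadd (tsign (odd_index i && odd_index j)) (tbl j i) [::])).

Lemma anti_ok : all_index (fun i => all_index (anti_check i)).
Proof. by vm_compute. Qed.

Lemma cube_ok : all_index (fun i => odd_index i ==> nilp (tbll i (tbl i i))).
Proof. by vm_compute. Qed.

Lemma parity_ok : all_index (fun i => all_index (fun j =>
  all (fun p => odd_index p.1 == odd_index i (+) odd_index j) (tbl i j))).
Proof. by vm_compute. Qed.

Lemma keys_ok : all_index (fun i => all_index (fun j =>
  all (fun p => p.1 < 18) (tbl i j))).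
Proof. by vm_compute. Qed.

Lemma tbl_out i j : 18 <= i \/ 18 <= j -> tbl i j = [::].
Proof.
rewrite /tbl => h; case: (leqP 18 i) h => [hi _|hi [|hj]].
- by rewrite (@nth_default _ [::] brj_table i) // nth_nil.
- by [].
apply: nth_default; apply: leq_trans hj.
have : all_index (fun i => size (nth [::] brj_table i) <= 18) by vm_compute.
by move/all_indexP; apply.
Qed.

Lemma tbl_keys i j : all (fun p => p.1 < 18) (tbl i j).
Proof.
case: (leqP 18 i) => hi; first by rewrite tbl_out //; left.
case: (leqP 18 j) => hj; first by rewrite tbl_out //; right.
exact: (all_indexP (all_indexP keys_ok hi) hj).
Qed.

(** The derivation D of the theorem; as 2 = -1, its values 2 y_2 and -2 y_6 become -y_2 and y_6. *)
Definition outer_table (i : nat) : sform nat :=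
  match i with
  | 1 => [:: (11, TM)]
  | 3 => [:: (9, TM)]
  | 5 => [:: (0, TP)]
  | 6 => [:: (2, TM)]
  | 8 => [:: (13, TP)]
  | 10 => [:: (14, TP)]
  | _ => [::]
  end.

(** Each y_k goes to x_k up to the sign (-1)^m, where m is the number of letters in the bracket y_k.
    For the h_i, [y_i, -x_i] = -h_i because x_i and y_i are odd. *)
Definition theta_table (i : nat) : sform nat := nth [::]
  [:: [:: (8, TP)]; [:: (9, TP)]; [:: (10, TP)]; [:: (11, TP)];
      [:: (12, TP)]; [:: (13, TP)]; [:: (14, TP)]; [:: (15, TP)];
      [:: (0, TM)]; [:: (1, TM)]; [:: (2, TP)]; [:: (3, TP)];
      [:: (4, TM)]; [:: (5, TP)]; [:: (6, TM)]; [:: (7, TP)];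
      [:: (16, TM)]; [:: (17, TM)]] i.

Definition theta_inv_table (i : nat) : sform nat := nth [::]
  [:: [:: (8, TM)]; [:: (9, TM)]; [:: (10, TP)]; [:: (11, TP)];
      [:: (12, TM)]; [:: (13, TP)]; [:: (14, TM)]; [:: (15, TP)];
      [:: (0, TP)]; [:: (1, TP)]; [:: (2, TP)]; [:: (3, TP)];
      [:: (4, TP)]; [:: (5, TP)]; [:: (6, TP)]; [:: (7, TP)];
      [:: (16, TM)]; [:: (17, TM)]] i.

Definition conj_outer_table (i : nat) : sform nat :=
  smap theta_table (smap outer_table (theta_inv_table i)).

Definition sym_check (f : nat -> sform nat) i :=
  [&& all (fun p => (p.1 < 18) && (odd_index p.1 == odd_index i)) (f i)
    & all_index (fun j => nilp (sadd TM (smap f (tbl i j)) (tbl2 (f i) (f j))))].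

Definition der_check (f : nat -> sform nat) i :=
  [&& all (fun p => (p.1 < 18) && (odd_index p.1 == ~~ odd_index i)) (f i)
    & all_index (fun j => nilp (sadd TM (smap f (tbl i j)) (sadd TP (tblr (f i) j)
        (sadd (tsign (odd_index i)) (tbll i (f j)) [::]))))].

Lemma theta_ok : all_index (sym_check theta_table).
Proof. by vm_compute. Qed.

Lemma theta_inv_ok : all_index (sym_check theta_inv_table).
Proof. by vm_compute. Qed.

Lemma theta_cancel : all_index (fun i =>
  (smap theta_inv_table (theta_table i) == [:: (i, TP)]) &&
  (smap theta_table (theta_inv_table i) == [:: (i, TP)])).
Proof. by vm_compute. Qed.

Lemma outer_table_ok : all_index (der_check outer_table).
Proof. by vm_compute. Qed.

Lemma outer_table_keys :
  all_index (fun i => all (fun p => p.1 < 18) (outer_table i)).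
Proof. by vm_compute. Qed.

Lemma conj_outer_table_keys :
  all_index (fun i => all (fun p => p.1 < 18) (conj_outer_table i)).
Proof. by vm_compute. Qed.

Lemma outer_theta_inv_keys :
  all_index (fun i =>
    all (fun p => p.1 < 18) (smap outer_table (theta_inv_table i))).
Proof. by vm_compute. Qed.

(* No inner derivation has a component from x_2 to y_4 or from y_2 to x_4.    *)
Lemma outer_ok :
  all_index (fun i => tzero (sconst i 1 11) && tzero (sconst i 9 3)).
Proof. by vm_compute. Qed.

(** * Linear systems for derivations and cocycles *)

Definition index_pairs := [seq (i, j) | i <- iota 0 18, j <- iota 0 18].
Definition index_triples (s : seq nat) := [seq (i, p) | i <- s, p <- index_pairs].
Definition key := (nat * nat)%type.

(* The unknown (a, b) is the coefficient of e_b in D e_a. In the coefficient  *)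
(* of e_l in D [e_i, e_j] only the component of D of parity p(i)+p(j)+p(l)    *)
(* matters; this determines the sign in the Leibniz rule, so that even and    *)
(* odd derivations obey the same equations.                                   *)
Definition der_eqn (i j l : nat) : sform key :=
  sadd TP [seq ((k, l), sconst i j k) | k <- iota 0 18]
  (sadd TM [seq ((i, b), sconst b j l) | b <- iota 0 18]
  (sadd (topp (tsign ((odd_index i (+) odd_index j (+) odd_index l)
                      && odd_index i)))
    [seq ((j, b), sconst i b l) | b <- iota 0 18] [::])).

(* It is enough to write the equations for i among x_1, x_2, y_1, y_2.        *)
Definition der_eqns :=
  [seq der_eqn q.1 q.2.1 q.2.2 | q <- index_triples [:: 0; 1; 8; 9]].

(* The k-th coordinate of the inner part u of D: a root vector e_k is         *)
(* recovered from its bracket with h_1 or h_2, and the Cartan part from the   *)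
(* diagonal entries at x_1 and x_2.                                           *)
Definition inner_form (k : nat) : sform key :=
  match k with
  | 16 => [:: ((0, 0), TP); ((1, 1), TM)]
  | 17 => [:: ((0, 0), TP)]
  | _ => if sconst k 16 k is T0 then [:: ((17, k), sconst k 17 k)]
         else [:: ((16, k), sconst k 16 k)]
  end.

(** The entry (a, b) of the candidate combination minus that of D. Both outer derivations have
    coefficient -1 at the component where they are detected, (1, 11) or (9, 3), which accounts for
    the signs of their terms. *)
Definition der_target (a b : nat) : sform key :=
  sadd TM [:: ((a, b), TP)]
  (sadd (topp (scoef (outer_table a) b)) [:: ((1, 11), TP)]
  (sadd (topp (scoef (conj_outer_table a) b)) [:: ((9, 3), TP)]
    (smap inner_form [seq (k, sconst k a b) | k <- iota 0 18]))).

Lemma der_ok : entails der_eqns [seq der_target q.1 q.2 | q <- index_pairs].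
Proof. by vm_compute. Qed.

(* The unknown (a, b) is the value of the cocycle at (e_a, e_b).              *)
Definition cocycle_eqn (i j k : nat) : sform key :=
  sadd TP [seq ((l, k), sconst i j l) | l <- iota 0 18]
  (sadd TM [seq ((i, l), sconst j k l) | l <- iota 0 18]
  (sadd (tsign (odd_index i && odd_index j))
    [seq ((j, l), sconst i k l) | l <- iota 0 18] [::])).

Definition anti_eqn (i j : nat) : sform key :=
  sadd TP [:: ((i, j), TP)]
  (sadd (tsign (odd_index i && odd_index j)) [:: ((j, i), TP)] [::]).

Definition cube_eqn (i : nat) : sform key :=
  if odd_index i then sadd TP [seq ((i, l), sconst i i l) | l <- iota 0 18] [::]
  else [::].

Definition coc_eqns :=
  [seq anti_eqn q.1 q.2 | q <- index_pairs] ++ [seq cube_eqn i | i <- iota 0 18]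
  ++ [seq cocycle_eqn q.1 q.2.1 q.2.2 | q <- index_triples [:: 0; 1; 8; 9]].

(* The value at e_k of a linear form whose coboundary is the cocycle.         *)
Definition cob_form (k : nat) : sform key :=
  match k with
  | 16 => [:: ((0, 8), TP)]
  | 17 => [:: ((1, 9), TP)]
  | _ => if sconst 16 k k is T0 then [:: ((17, k), sconst 17 k k)]
         else [:: ((16, k), sconst 16 k k)]
  end.

(** The candidate f comes from h_i = [x_i, y_i] and from [h_j, e_k] = c e_k with c = 1 or -1 for a
    root vector e_k and a suitable j: f(h_i) is the value at (x_i, y_i), and f(e_k) is c times the
    value at (h_j, e_k). *)
Definition coc_target (a b : nat) : sform key :=
  sadd TM [:: ((a, b), TP)]
    (smap cob_form [seq (k, sconst a b k) | k <- iota 0 18]).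

Lemma coc_ok : entails coc_eqns [seq coc_target q.1 q.2 | q <- index_pairs].
Proof. by vm_compute. Qed.

Import GRing.Theory.
Local Open Scope ring_scope.

Lemma sum_iota (V : nmodType) (I : Type) (c : nat -> I) (F : I -> V) n :
  \sum_(p <- [seq c k | k <- iota 0 n]) F p = \sum_(k < n) F (c k).
Proof.
by rewrite big_map -(big_mkord xpredT (F \o c)) /index_iota subn0.
Qed.

(** * Evaluation of forms over F_3 in vector spaces of characteristic 3 *)

Section Eval.
Variables (K : fieldType).
Hypothesis charK : 3%N \in [pchar K].

Definition tK (c : trit) : K := match c with T0 => 0 | TP => 1 | TM => -1 end.

Lemma three0 : 1 + 1 + 1 = 0 :> K.
Proof. by have := pcharf0 charK; rewrite -natr1 -natr1. Qed.

Lemma tKD a b : tK (tadd a b) = tK a + tK b.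
Proof.
have h := three0; have h1 : 1 + 1 = -1 :> K by apply/eqP; rewrite -addr_eq0 h.
by case: a; case: b; rewrite /= ?addr0 ?add0r ?subrr ?addNr ?h1 // -opprD h1 opprK.
Qed.

Lemma tKN a : tK (topp a) = - tK a.
Proof. by case: a; rewrite /= ?oppr0 ?opprK. Qed.

Lemma tKM a b : tK (tmul a b) = tK a * tK b.
Proof. by case: a => /=; rewrite ?mul0r ?mul1r // tKN mulN1r. Qed.

Lemma tK_sign b : tK (tsign b) = (-1) ^+ b.
Proof. by case: b. Qed.

Lemma tK_eq0 c : (tK c == 0) = tzero c.
Proof. by case: c; rewrite /= ?eqxx ?oppr_eq0 ?oner_eq0. Qed.

Variables (I : eqType) (V : lmodType K).
Implicit Types (f : I -> V) (u v : sform I) (B : seq (I * sform I)).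

Definition seval f u : V := \sum_(p <- u) tK p.2 *: f p.1.

Lemma seval0 f : seval f [::] = 0.
Proof. by rewrite /seval big_nil. Qed.

Lemma seval_cons f k c u : seval f ((k, c) :: u) = tK c *: f k + seval f u.
Proof. by rewrite /seval big_cons. Qed.

Lemma seval1 f k : seval f [:: (k, TP)] = f k.
Proof. by rewrite seval_cons seval0 addr0 scale1r. Qed.

Definition smono (k : I) (c : trit) : sform I :=
  if tzero c then [::] else [:: (k, c)].

Lemma seval_mono f k c : seval f (smono k c) = tK c *: f k.
Proof. by case: c; rewrite /= ?seval_cons seval0 ?scale0r ?addr0. Qed.

Lemma seval_put f k c u : seval f (sput k c u) = tK c *: f k + seval f u.
Proof.
elim: u => [|[k' c'] u IH] /=.
  by case: c; rewrite /= ?seval0 ?seval_cons ?seval0 ?addr0 ?scale0r.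
case: eqP => [ <-|_]; last by rewrite !seval_cons IH addrCA.
rewrite seval_cons addrA -scalerDl -tKD.
by case: (tadd c c'); rewrite /= ?seval_cons //= scale0r add0r.
Qed.

Lemma seval_add f c u v : seval f (sadd c u v) = tK c *: seval f u + seval f v.
Proof.
elim: u => [|[k d] u IH] /=; first by rewrite seval0 scaler0 add0r.
rewrite seval_cons scalerDr -addrA -IH scalerA -tKM.
by case: d => /=; rewrite ?seval_put // tKM mulr0 scale0r add0r.
Qed.

Lemma seval_iota f (F : nat -> I) (c : nat -> trit) n :
  seval f [seq (F k, c k) | k <- iota 0 n] = \sum_(k < n) tK (c k) *: f (F k).
Proof. by rewrite /seval sum_iota. Qed.

Lemma reduceP f B u : (forall p, p \in B -> seval f p.2 = 0) ->
  seval f (reduce B u) = seval f u.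
Proof.
elim: B u => [//|p B IH] u hB; rewrite [reduce _ _]/=.
rewrite IH => [|q hq]; last by apply: hB; rewrite inE hq orbT.
by case: tzero => //; rewrite seval_add hB ?inE ?eqxx // scaler0 add0r.
Qed.

(** Every row of the echelon basis is a combination of forms of E and so evaluates to 0; subtracting
    such rows does not change the value of t. This is the soundness of elimination; its success on
    the two systems is the content of [der_ok] and [coc_ok]. *)
Lemma entailsP f (E T : seq (sform I)) : entails E T ->
  (forall u, u \in E -> seval f u = 0) -> forall t, t \in T -> seval f t = 0.
Proof.
rewrite /entails /echelon => hT hE t tT.
suff hB p : p \in foldl (@insert _) [::] E -> seval f p.2 = 0.
  by rewrite -(reduceP _ hB); move/allP: hT => /(_ t tT)/nilP ->; apply: seval0.
suff: forall B : seq (I * sform I), (forall p, p \in B -> seval f p.2 = 0) ->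
    forall p, p \in foldl (@insert _) B E -> seval f p.2 = 0.
  by move=> /(_ [::]) h; apply: h.
elim: E hE {hT} => [//|u E IH] hE B hB; apply: IH => [v hv|].
  by apply: hE; rewrite inE hv orbT.
move=> q; rewrite /insert; have := reduceP u hB.
rewrite (hE u) ?mem_head //; case: (reduce B u) => [_|[k c] r hr]; first exact: hB.
rewrite mem_rcons inE => /orP[/eqP->|/hB //].
by rewrite seval_add seval0 hr scaler0 addr0.
Qed.

Lemma seval_smap (J : eqType) f (F : J -> sform I) (u : sform J) :
  seval f (smap F u) = \sum_(p <- u) tK p.2 *: seval f (F p.1).
Proof.
elim: u => [|[k c] u IH] /=; first by rewrite seval0 big_nil.
by rewrite seval_add big_cons IH.
Qed.

End Eval.

Lemma sbr_suml (K : fieldType) (L : superalgType K) (I : Type) (r : seq I)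
  (P : pred I) (g : I -> L) v :
  [< \sum_(i <- r | P i) g i, v >] = \sum_(i <- r | P i) [< g i, v >].
Proof.
by apply: (big_morph (fun u => [< u, v >])) => [a b|]; rewrite ?sbrDl ?sbr0l.
Qed.

(** * Lie superalgebras with these structure constants *)

Section Presentation.
Variables (K : fieldType) (charK : 3%N \in [pchar K]) (L : superalgType K).
Variables (e : nat -> L) (co : nat -> L -> K).

(** Shared by the model and by g, so that the cohomology can be computed for either. It asks only
    for a [superalgType], because the Lie axioms of the model are derived from it. The bracket
    clause also covers indices from 18 on, where [tbl] is empty and [e] is 0 in both instances. *)
Definition presentation : Prop :=
  [/\ forall k c u v, co k (c *: u + v) = c * co k u + co k v,
      forall i k, (i < 18)%N -> co k (e i) = (i == k)%:R,
      forall x, x = \sum_(i < 18) co i x *: e i,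
      forall a x, x \in spart a <->
        forall k, (k < 18)%N -> co k x != 0 -> odd_index k = a
    & forall i j, [< e i, e j >] = seval e (tbl i j)].

Hypothesis pres : presentation.

Lemma co_linear k : linear_for *%R (co k).
Proof. by case: pres => + _ _ _ _; apply. Qed.

HB.instance Definition _ k :=
  GRing.isLinear.Build K L K *%R (co k) (co_linear k).

Lemma co_basis i k : (i < 18)%N -> co k (e i) = (i == k)%:R.
Proof. by case: pres => _ + _ _ _; apply. Qed.

Lemma co_sum x : x = \sum_(i < 18) co i x *: e i.
Proof. by case: pres. Qed.

Lemma co_part a x : x \in spart a <->
  forall k, (k < 18)%N -> co k x != 0 -> odd_index k = a.
Proof. by case: pres => _ _ _ + _; apply. Qed.

Lemma co_br i j : [< e i, e j >] = seval e (tbl i j).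
Proof. by case: pres. Qed.

Lemma basis_part i : (i < 18)%N -> e i \in spart (odd_index i).
Proof.
move=> hi; apply/co_part => k _; rewrite co_basis //.
by have [->|_] := eqVneq i k; rewrite ?eqxx.
Qed.

Lemma coP x y : (forall k, (k < 18)%N -> co k x = co k y) -> x = y.
Proof.
by move=> h; rewrite (co_sum x) (co_sum y); apply: eq_bigr => i _; rewrite h.
Qed.

Lemma part_ind a (P : L -> Prop) :
  P 0 -> (forall c u v, P u -> P v -> P (c *: u + v)) ->
  (forall i, (i < 18)%N -> odd_index i = a -> P (e i)) ->
  forall x, x \in spart a -> P x.
Proof.
move=> P0 PD Pe x /co_part hx; rewrite (co_sum x).
apply: big_ind => [//|u v hu hv|i _]; first by rewrite -[u]scale1r; apply: PD.
have [->|/hx h] := eqVneq (co i x) 0; first by rewrite scale0r.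
by rewrite -[_ *: _]addr0; apply: PD => //; apply: Pe => //; apply: h.
Qed.

Lemma basis_ind (P : L -> Prop) :
  P 0 -> (forall c u v, P u -> P v -> P (c *: u + v)) ->
  (forall i, (i < 18)%N -> P (e i)) -> forall x, P x.
Proof.
move=> P0 PD Pe x; rewrite (co_sum x).
apply: big_ind => [//|u v hu hv|i _]; first by rewrite -[u]scale1r; apply: PD.
by rewrite -[_ *: _]addr0; apply: PD => //; apply: Pe.
Qed.

Lemma seval_tbll i u : [< e i, seval e u >] = seval e (tbll i u).
Proof.
rewrite (seval_smap charK) raddf_sum; apply: eq_bigr => p _ /=.
by rewrite sbrZr co_br.
Qed.

Lemma seval_tblr u j : [< seval e u, e j >] = seval e (tblr u j).
Proof.
rewrite (seval_smap charK) sbr_suml; apply: eq_bigr => p _.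
by rewrite sbrZl co_br.
Qed.

Lemma seval_tbl2 u v : [< seval e u, seval e v >] = seval e (tbl2 u v).
Proof.
rewrite (seval_smap charK) sbr_suml; apply: eq_bigr => p _.
by rewrite sbrZl seval_tbll.
Qed.

Lemma basis_jacobi i j k : (i < 18)%N -> (j < 18)%N -> (k < 18)%N ->
  [< e i, [< e j, e k >] >] = [< [< e i, e j >], e k >]
    + (-1) ^+ (odd_index i && odd_index j) *: [< e j, [< e i, e k >] >].
Proof.
move=> hi hj hk; rewrite !co_br !(seval_tbll, seval_tblr).
have /nilP := all_indexP (all_indexP (all_indexP jacobi_ok hi) hj) hk.
move/(congr1 (seval e)); rewrite !seval_add // seval0 addr0 tK_sign scale1r.
by rewrite scaleN1r addrC => /subr0_eq.
Qed.

Lemma basis_anti i j : (i < 18)%N -> (j < 18)%N ->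
  [< e i, e j >] = - ((-1) ^+ (odd_index i && odd_index j) *: [< e j, e i >]).
Proof.
move=> hi hj; rewrite !co_br.
have /nilP := all_indexP (all_indexP anti_ok hi) hj.
move/(congr1 (seval e)); rewrite !seval_add // seval0 addr0 tK_sign scale1r.
by move/eqP; rewrite addr_eq0 => /eqP.
Qed.

Lemma pres_anti a b (u v : L) : u \in spart a -> v \in spart b ->
  [< u, v >] = - ((-1) ^+ (a && b) *: [< v, u >]).
Proof.
move=> + hv; move: u; apply: part_ind => [|c u w hu hw|i hi pi].
- by rewrite sbr0l raddf0 scaler0 oppr0.
- by rewrite sbrDl sbrZl hu hw sbrDr sbrZr scalerDr !scalerN !scalerA mulrC opprD.
move: v hv; apply: part_ind => [|c u w hu hw|j hj pj].
- by rewrite sbr0l raddf0 scaler0 oppr0.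
- by rewrite sbrDl sbrZl sbrDr sbrZr hu hw scalerDr !scalerN !scalerA mulrC opprD.
by rewrite -pi -pj; apply: basis_anti.
Qed.

Lemma pres_jacobi a b (u v w : L) : u \in spart a -> v \in spart b ->
  [< u, [< v, w >] >] =
    [< [< u, v >], w >] + (-1) ^+ (a && b) *: [< v, [< u, w >] >].
Proof.
move=> + hv; move: u; apply: part_ind => [|c u u' hu hu'|i hi pi].
- by rewrite !(sbr0l, raddf0, scaler0, addr0).
- rewrite !(sbrDl, sbrZl, sbrDr, sbrZr) hu hu' !scalerDr !scalerA.
  by rewrite mulrC addrACA.
move: v hv; apply: part_ind => [|c u u' hu hu'|j hj pj].
- by rewrite !(sbr0l, raddf0, scaler0, addr0).
- rewrite !(sbrDl, sbrZl, sbrDr, sbrZr) hu hu' !scalerDr !scalerA.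
  by rewrite mulrC addrACA.
move: w; apply: basis_ind => [|c u u' hu hu'|k hk].
- by rewrite !(raddf0, scaler0, addr0).
- by rewrite !(sbrDr, sbrZr) hu hu' !scalerDr !scalerA mulrC addrACA.
by rewrite -pi -pj; apply: basis_jacobi.
Qed.

(* By the Jacobi identity the polarization of the cube vanishes, so that the *)
(* cube is additive on the odd part.                                         *)
Lemma pres_cube (u : L) : u \in spart true -> [< u, [< u, u >] >] = 0.
Proof.
move=> hu; suff: u \in spart true /\ [< u, [< u, u >] >] = 0 by case.
move: u hu; apply: part_ind => [|c u v [hu u3] [hv v3]|i hi pi].
- by rewrite sbr0l rpred0.
- have mix (x y : L) : x \in spart true -> y \in spart true ->
      [< x, [< x, y >] >] *+ 2 + [< y, [< x, x >] >] = 0.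
    move=> hx hy; have hxx := spart_br _ _ _ _ hx hx.
    rewrite mulr2n {1}(pres_jacobi _ hx hx) /= expr1 scaleN1r subrK.
    by rewrite (pres_anti hxx hy) /= scale1r addNr.
  split; first by rewrite rpredD ?rpredZ.
  have hcu : c *: u \in spart true by rewrite rpredZ.
  have cu3 : [< c *: u, [< c *: u, c *: u >] >] = 0.
    by rewrite !(sbrZl, sbrZr) u3 !scaler0.
  move: (c *: u) hcu cu3 => {c u hu u3}u hu u3.
  have := mix _ _ hu hv; have := mix _ _ hv hu.
  have -> : [< v, u >] = [< u, v >].
    by rewrite (pres_anti hv hu) /= expr1 scaleN1r opprK.
  rewrite !(sbrDl, sbrDr) u3 v3 add0r addr0 => m1 m2.
  rewrite -[RHS]addr0 -{1}m2 -m1 !mulr2n (pres_anti hv hu) /= expr1 scaleN1r.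
  by rewrite opprK (AC ((1*2)*3) ((1*2*4)*(5*6*3)))%AC.
split; first by rewrite -pi basis_part.
rewrite co_br seval_tbll; have := all_indexP cube_ok hi; rewrite pi => /nilP ->.
exact: seval0.
Qed.

Lemma co_seval k u : all (fun p => (p.1 < 18)%N) u ->
  co k (seval e u) = tK K (scoef u k).
Proof.
elim: u => [_|[i c] u IH] /=; first by rewrite seval0 raddf0.
move=> /andP[hi /IH hu]; rewrite seval_cons raddfD /= linearZ /= hu co_basis //.
by have [_|_] := eqVneq i k; rewrite ?mulr1 ?mulr0 ?add0r // tKD.
Qed.

Lemma co_brr k x j :
  co k [< x, e j >] = \sum_(i < 18) co i x * tK K (sconst i j k).
Proof.
rewrite {1}(co_sum x) sbr_suml raddf_sum; apply: eq_bigr => i _ /=.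
by rewrite sbrZl linearZ /= co_br co_seval // tbl_keys.
Qed.

Lemma co_brl k i x :
  co k [< e i, x >] = \sum_(j < 18) co j x * tK K (sconst i j k).
Proof.
rewrite {1}(co_sum x) raddf_sum raddf_sum; apply: eq_bigr => j _ /=.
by rewrite sbrZr linearZ /= co_br co_seval // tbl_keys.
Qed.

End Presentation.

(** * The 18-dimensional model *)

Section Model.
Variable K : fieldType.

Definition brj_vect : Type := 'rV[K]_18.
HB.instance Definition _ := GRing.Lmodule.on brj_vect.
Implicit Types u v : brj_vect.

Definition mcoord (k : nat) (v : brj_vect) : K :=
  if insub k is Some i then v 0 i else 0.

Definition mbasis (k : nat) : brj_vect := \row_j (j == k :> nat)%:R.

Definition mbr u v : brj_vect :=
  \sum_(i < 18) \sum_(j < 18) (u 0 i * v 0 j) *: seval mbasis (tbl i j).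

Definition mpart (b : bool) : {pred brj_vect} :=
  [pred v : brj_vect | [forall i, (v 0 i != 0) ==> (odd_index i == b)]].

Lemma mpartP b v :
  reflect (forall i, v 0 i != 0 -> odd_index i = b) (v \in mpart b).
Proof.
apply: (iffP forallP) => h i; first by move/(implyP (h i))/eqP.
by apply/implyP => /h ->.
Qed.

Fact mpart_closed b : submod_closed (mpart b).
Proof.
split; first by apply/mpartP => i; rewrite mxE eqxx.
move=> c u v /mpartP hu /mpartP hv; apply/mpartP => i; rewrite !mxE.
have [->|/hu //] := eqVneq (u 0 i) 0; rewrite mulr0 add0r; exact: hv.
Qed.

HB.instance Definition _ b :=
  GRing.isSubmodClosed.Build K brj_vect (mpart b) (mpart_closed b).

Fact mpart_sum v : exists2 u, u \in mpart false & v - u \in mpart true.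
Proof.
exists (\row_i if odd_index i then 0 else v 0 i); apply/mpartP => i;
  rewrite !mxE; case: (odd_index i) => //; first by rewrite eqxx.
by rewrite subrr eqxx.
Qed.

Fact mpart_disj v : v \in mpart false -> v \in mpart true -> v = 0.
Proof.
move=> /mpartP h0 /mpartP h1; apply/rowP => i; rewrite mxE.
by apply/eqP/negPn/negP => h; have := h0 i h; rewrite (h1 i h).
Qed.

Fact mbr_linearl v : linear (mbr^~ v).
Proof.
move=> c u1 u2; rewrite /mbr scaler_sumr -big_split; apply: eq_bigr => i _.
rewrite scaler_sumr -big_split; apply: eq_bigr => j _ /=.
by rewrite !mxE mulrDl scalerDl scalerA mulrA.
Qed.

Fact mbr_linearr u : linear (mbr u).
Proof.
move=> c v1 v2; rewrite /mbr scaler_sumr -big_split; apply: eq_bigr => i _.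
rewrite scaler_sumr -big_split; apply: eq_bigr => j _ /=.
by rewrite !mxE mulrDr scalerDl scalerA mulrCA.
Qed.

Lemma mbasis_out k : (18 <= k)%N -> mbasis k = 0.
Proof.
move=> hk; apply/rowP => j; rewrite !mxE; have := ltn_ord j.
by case: eqP => // ->; rewrite ltnNge hk.
Qed.

Lemma mbasis_part k : mbasis k \in mpart (odd_index k).
Proof.
apply/mpartP => i; rewrite mxE.
by have [->//|_] := eqVneq (i : nat) k; rewrite eqxx.
Qed.

Lemma seval_mpart b (u : sform nat) :
  all (fun p => odd_index p.1 == b) u -> seval mbasis u \in mpart b.
Proof.
move/allP => h; rewrite /seval big_seq; apply: rpred_sum => p /h/eqP <-.
by apply: rpredZ; apply: mbasis_part.
Qed.

Fact mpart_br a b u v :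
  u \in mpart a -> v \in mpart b -> mbr u v \in mpart (a (+) b).
Proof.
move=> /mpartP hu /mpartP hv; apply: rpred_sum => i _; apply: rpred_sum => j _.
have [->|/hu <-] := eqVneq (u 0 i) 0; first by rewrite mul0r scale0r rpred0.
have [->|/hv <-] := eqVneq (v 0 j) 0; first by rewrite mulr0 scale0r rpred0.
apply: rpredZ; apply: seval_mpart.
exact: (all_indexP (all_indexP parity_ok (ltn_ord i)) (ltn_ord j)).
Qed.

HB.instance Definition _ := Lmodule_isSuperalg.Build K brj_vect
  mpart_closed mpart_sum mpart_disj mbr_linearl mbr_linearr mpart_br.

Lemma mbr_basis i j : [< mbasis i, mbasis j >] = seval mbasis (tbl i j).
Proof.
case: (leqP 18 i) => hi.
  by rewrite mbasis_out // sbr0l tbl_out ?seval0 //; left.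
case: (leqP 18 j) => hj.
  by rewrite (mbasis_out hj) raddf0 tbl_out ?seval0 //; right.
rewrite [LHS](bigD1 (Ordinal hi)) //= (bigD1 (Ordinal hj)) //=.
rewrite !mxE !eqxx mulr1 scale1r !big1 ?addr0 // => [k|k].
  rewrite -val_eqE /= => hk; apply: big1 => l _.
  by rewrite mxE (negPf hk) mul0r scale0r.
by rewrite -val_eqE /= => hk; rewrite [X in _ * X]mxE (negPf hk) mulr0 scale0r.
Qed.

Lemma mcoordE k (hk : (k < 18)%N) v : mcoord k v = v 0 (Ordinal hk).
Proof. by rewrite /mcoord insubT. Qed.

Lemma model_presentation : presentation mbasis mcoord.
Proof.
split.
- move=> k c u v; rewrite /mcoord; case: insub => [i|]; first by rewrite !mxE.
  by rewrite mulr0 addr0.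
- move=> i k hi; rewrite /mcoord.
  case: insubP => [j _ <-|]; first by rewrite mxE eq_sym.
  by case: eqP => // <-; rewrite hi.
- move=> v; apply/rowP => j; rewrite summxE (bigD1 j) //= big1 => [|i ij].
    rewrite !mxE eqxx mulr1 addr0 /mcoord insubT ?ltn_ord // => h.
    by congr (v 0 _); apply: val_inj.
  by rewrite !mxE eq_sym (inj_eq val_inj) (negPf ij) mulr0.
- move=> a v; split => [/mpartP h k hk|h].
    by rewrite mcoordE; apply: (h (Ordinal hk)).
  apply/mpartP => i hi; apply: h; rewrite ?ltn_ord // mcoordE.
  by rewrite (_ : Ordinal _ = i) //; apply: val_inj.
exact: mbr_basis.
Qed.

(** The Lie axioms are proved from characteristic 3. Making its proof a parameter of the type lets
    the Lie structure be inferred from the type. *)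
Definition brj_model (charK : 3%N \in [pchar K]) : Type := brj_vect.
HB.instance Definition _ charK := Superalg.on (brj_model charK).
HB.instance Definition _ charK := Superalg_isLie.Build K (brj_model charK)
  (pres_anti charK model_presentation) (pres_jacobi charK model_presentation)
  (pres_cube charK model_presentation).

End Model.

(** * Lie superalgebras of Cartan matrices *)

Section FreeLift.
Variables (K : fieldType) (T : Type) (p : T -> bool) (L : superalgType K).
Variable f : T -> L.
Local Notation F := (free_superalg K p).

Fixpoint weval (w : word T) : L :=
  match w with
  | Letter t => f t
  | Node w1 w2 => [< weval w1, weval w2 >]
  end.

Definition feval (u : F) : L := fglift weval u.

Fact feval_linear : linear feval.
Proof. exact: linearP. Qed.
HB.instance Definition _ := GRing.isLinear.Build K F L *:%R feval feval_linear.

Lemma feval_word c w : feval (<< c *g w >> : F) = c *: weval w.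
Proof. by rewrite /feval /= liftU. Qed.

Lemma word_ind (P : F -> Prop) :
  P 0 -> (forall c u v, P u -> P v -> P (c *: u + v)) ->
  (forall w, P << w >>) -> forall u, P u.
Proof.
move=> P0 PD Pw u; rewrite -[u]freeg_sumE.
apply: big_ind => [//|v1 v2 h1 h2|w _].
  by rewrite -[v1]scale1r; apply: PD.
have -> : << coeff w u *g w >> = coeff w u *: (<< w >> : F) + 0.
  by rewrite addr0; apply/eqP/freeg_eqP => w'; rewrite coeffZ !coeffU mul1r.
exact: PD.
Qed.

Lemma free_br_word w1 w2 : [< (<< w1 >> : F), (<< w2 >> : F) >] = << Node w1 w2 >>.
Proof.
rewrite [LHS](_ : _ = free_br (<< w1 >> : F) << w2 >>) //.
by rewrite /free_br !liftU !scale1r.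
Qed.

Lemma feval_br (u v : F) : feval [< u, v >] = [< feval u, feval v >].
Proof.
move: u; apply: word_ind => [|c u1 u2 h1 h2|w1]; first by rewrite !(sbr0l, raddf0).
  by rewrite sbrDl sbrZl !linearP /= h1 h2 sbrDl sbrZl.
move: v; apply: word_ind => [|c u1 u2 h1 h2|w2]; first by rewrite !raddf0.
  by rewrite sbrDr sbrZr !linearP /= h1 h2.
by rewrite free_br_word !feval_word !scale1r.
Qed.

Hypothesis f_part : forall t, f t \in spart (p t).

Lemma weval_part w : weval w \in spart (wparity p w).
Proof. by elim: w => [t|w1 h1 w2 h2] /=; [apply: f_part|apply: spart_br]. Qed.

Lemma feval_part b u : u \in spart b -> feval u \in spart b.
Proof.
move=> /free_partP hu; rewrite /feval fgliftE big_seq.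
by apply: rpred_sum => w; rewrite mem_dom => /hu <-; apply/rpredZ/weval_part.
Qed.

End FreeLift.

Section CartanLift.
Variables (K : fieldType) (n : nat) (A : 'M[K]_n) (p : 'I_n -> bool).
Variables (L : lieSuperType K) (f : chevalley n -> L).
Local Notation par := (chevalley_parity p).
Local Notation F := (free_superalg K par).
Local Notation gt := (gtilde A p).

Hypothesis f_part : forall t, f t \in spart (par t).
Hypothesis f_HH : forall i j, [< f (GenH i), f (GenH j) >] = 0.
Hypothesis f_HX : forall i j, [< f (GenH i), f (GenX j) >] = A i j *: f (GenX j).
Hypothesis f_HY : forall i j,
  [< f (GenH i), f (GenY j) >] = - (A i j *: f (GenY j)).
Hypothesis f_XY : forall i j,
  [< f (GenX i), f (GenY j) >] = f (GenH i) *+ (i == j).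

Local Notation fev := (@feval _ _ par L f).

Lemma feval_relator r : cartan_relator A r -> fev r = 0.
Proof.
have part := feval_part f_part.
case=> [u|i j|i j|i j|i j].
- case=> [a b v w hv hw|a b c u1 v w hu hv hw|v hv].
  + rewrite raddfD /= linearZ /= !feval_br.
    by rewrite (sbr_anti _ _ _ _ (part _ _ hv) (part _ _ hw)) addNr.
  + rewrite raddfB /= raddfD /= linearZ /= !feval_br.
    by rewrite (sbr_jacobi _ _ _ _ _ (part _ _ hu) (part _ _ hv)) subrr.
  + by rewrite !feval_br sbr_cube //; apply: part.
- by rewrite feval_br !feval_word !scale1r; apply: f_HH.
- by rewrite raddfB /= linearZ /= feval_br !feval_word !scale1r /= f_HX subrr.
- by rewrite raddfD /= linearZ /= feval_br !feval_word !scale1r /= f_HY addNr.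
by rewrite raddfB /= raddfMn /= feval_br !feval_word !scale1r /= f_XY subrr.
Qed.

(** The vectors killed by [fev] form an absorbing subspace containing the relators, and
    [cartan_ideal] is the least one. *)
Lemma feval_ideal u : u \in cartan_ideal A p -> fev u = 0.
Proof.
move=> /gen_idealP /(_ [pred v | fev v == 0]) h; apply/eqP; apply: h.
  split; first split; rewrite ?inE ?raddf0 //.
    move=> c v w; rewrite !inE linearP /= => /eqP-> /eqP->.
    by rewrite scaler0 addr0.
  move=> v w; rewrite !inE !feval_br => /eqP->.
  by rewrite sbr0l raddf0 eqxx.
by move=> r hr; rewrite inE feval_relator.
Qed.

Definition tlift (q : gt) : L := fev (repr q).

Lemma tlift_lpi u : tlift (lpi (cartan_ideal A p) u) = fev u.
Proof.
apply/eqP; rewrite /tlift -subr_eq0 -raddfB /=; apply/eqP/feval_ideal.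
by apply/lpi_eq; rewrite lpi_surj.
Qed.

Fact tlift_linear : linear tlift.
Proof.
move=> c u v; rewrite -(lpi_surj u) -(lpi_surj v) -linearP.
by rewrite !tlift_lpi linearP.
Qed.
HB.instance Definition _ :=
  GRing.isLinear.Build K gt L *:%R tlift tlift_linear.

Lemma tlift_br (u v : gt) : tlift [< u, v >] = [< tlift u, tlift v >].
Proof.
rewrite -(lpi_surj u) -(lpi_surj v).
by rewrite -(lpi_sbr (cartan_ideal A p)) !tlift_lpi feval_br.
Qed.

Lemma tlift_part b u : u \in spart b -> tlift u \in spart b.
Proof. by move=> /qpartP[v hv ->]; rewrite tlift_lpi feval_part. Qed.

Lemma tlift_gen t : tlift (tgen A p t) = f t.
Proof. by rewrite tlift_lpi feval_word scale1r. Qed.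

End CartanLift.

(** * Triangular decomposition *)

Section Tower.
Variables (K : fieldType) (n : nat) (p : 'I_n -> bool) (L : lieSuperType K).

Section OneSide.
Variables (x y h : 'I_n -> L).

(* The span of the right-normed brackets of k + 1 elements x_i.               *)
Fixpoint tower (k : nat) (v : L) : Prop :=
  match k with
  | 0 => exists c : 'I_n -> K, v = \sum_i c i *: x i
  | k'.+1 => exists2 g : 'I_n -> L, forall i, tower k' (g i)
                                  & v = \sum_i [< x i, g i >]
  end.

Definition torus (v : L) : Prop := exists c : 'I_n -> K, v = \sum_i c i *: h i.

Lemma sum_lin (z : 'I_n -> L) (c : K) a b :
  c *: (\sum_i a i *: z i) + \sum_i b i *: z i = \sum_i (c * a i + b i) *: z i.
Proof.
rewrite scaler_sumr -big_split; apply: eq_bigr => i _.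
by rewrite scalerDl scalerA.
Qed.

Lemma torus_lin c u v : torus u -> torus v -> torus (c *: u + v).
Proof. by move=> [a ->] [b ->]; eexists; apply: sum_lin. Qed.

Lemma sum0 (z : 'I_n -> L) : 0 = \sum_i 0 *: z i.
Proof. by rewrite big1 // => i _; rewrite scale0r. Qed.

Lemma sum1 (z : 'I_n -> L) j : z j = \sum_i (i == j)%:R *: z i.
Proof.
rewrite (bigD1 j) //= eqxx scale1r big1 ?addr0 // => i /negPf->.
by rewrite scale0r.
Qed.

Lemma tower_lin k c u v : tower k u -> tower k v -> tower k (c *: u + v).
Proof.
elim: k u v => [|k IH] u v /=.
  by move=> [a ->] [b ->]; eexists; apply: sum_lin.
move=> [f hf ->] [g hg ->]; exists (fun i => c *: f i + g i).
  by move=> i; apply: IH.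
rewrite scaler_sumr -big_split; apply: eq_bigr => i _.
by rewrite sbrDr sbrZr.
Qed.

Lemma tower0 k : tower k 0.
Proof.
elim: k => [|k IH] /=; first by exists (fun=> 0); apply: sum0.
by exists (fun=> 0) => //; rewrite big1 // => i _; rewrite raddf0.
Qed.

Lemma tower_sum k (g : 'I_n -> L) :
  (forall i, tower k (g i)) -> tower k (\sum_i g i).
Proof.
move=> hg; apply: big_ind => [|u v hu hv|i _ //]; first exact: tower0.
by rewrite -[u]scale1r; apply: tower_lin.
Qed.

Lemma torus_sum (g : 'I_n -> L) : (forall i, torus (g i)) -> torus (\sum_i g i).
Proof.
move=> hg; apply: big_ind => [|u v hu hv|i _ //].
  by exists (fun=> 0); apply: sum0.
by rewrite -[u]scale1r; apply: torus_lin.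
Qed.

Lemma towerZ k c u : tower k u -> tower k (c *: u).
Proof.
by move=> hu; rewrite -[_ *: _]addr0; apply: tower_lin => //; apply: tower0.
Qed.

Lemma tower1 i : tower 0 (x i).
Proof. by eexists; apply: (sum1 x i). Qed.

Lemma torusZ c u : torus u -> torus (c *: u).
Proof.
move=> hu; rewrite -[_ *: _]addr0; apply: torus_lin => //.
by exists (fun=> 0); apply: sum0.
Qed.

Hypothesis x_part : forall i, x i \in spart (p i).
Hypothesis y_part : forall i, y i \in spart (p i).
Hypothesis h_part : forall i, h i \in spart false.
Hypothesis h_x : forall j i, exists c, [< h j, x i >] = c *: x i.
Hypothesis y_x : forall j i, torus [< y j, x i >].

Lemma tower_x k i v : tower k v -> tower k.+1 [< x i, v >].
Proof.
move=> hv; exists (fun j => if j == i then v else 0).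
  by move=> j; case: ifP => _ //; apply: tower0.
rewrite (bigD1 i) //= eqxx big1 ?addr0 // => j /negPf->.
by rewrite raddf0.
Qed.

Lemma tower_h k j v : tower k v -> tower k [< h j, v >].
Proof.
elim: k v => [|k IH] v.
  move=> [c ->]; rewrite raddf_sum; apply: (@tower_sum 0) => i /=.
  have [d hd] := h_x j i; rewrite sbrZr hd.
  by do 2!apply: (@towerZ 0); apply: tower1.
move=> [g hg ->]; rewrite raddf_sum; apply: (@tower_sum k.+1) => i /=.
rewrite (sbr_jacobi _ _ _ _ _ (h_part j) (x_part i)) /= scale1r.
have [c ->] := h_x j i; rewrite sbrZl -sbrZr -raddfD /=.
by apply: (@tower_x k); apply: tower_lin; [apply: hg|apply/IH/hg].
Qed.

Lemma tower_torus k u v : torus u -> tower k v -> tower k [< u, v >].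
Proof.
move=> [c ->] hv; rewrite sbr_suml.
by apply: tower_sum => i; rewrite sbrZl; apply: towerZ; apply: tower_h.
Qed.

Lemma x_torus i u : torus u -> tower 0 [< x i, u >].
Proof.
move=> [c ->]; rewrite raddf_sum; apply: (@tower_sum 0) => j.
rewrite /= sbrZr (sbr_anti _ _ _ _ (x_part i) (h_part j)) andbF scale1r.
have [d ->] := h_x j i; rewrite -scaleNr.
by do 2!apply: (@towerZ 0); apply: tower1.
Qed.

Lemma y_tower0 j v : tower 0 v -> torus [< y j, v >].
Proof.
move=> [c ->]; rewrite raddf_sum; apply: torus_sum => i /=.
by rewrite sbrZr; apply: torusZ.
Qed.

(** By Jacobi, [y_j, [x_i, g]] is [[y_j, x_i], g], where a torus element acts on a tower, plus or
    minus [x_i, [y_j, g]], where induction applies. The section is used twice, the second time with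
    x and y exchanged. *)
Lemma y_tower k j v : tower k.+1 v -> tower k [< y j, v >].
Proof.
elim: k v => [|k IH] v [g hg ->]; rewrite raddf_sum; apply: tower_sum => i.
  rewrite /= (sbr_jacobi _ _ _ _ _ (y_part j) (x_part i)) addrC.
  apply: (@tower_lin 0); first by apply: x_torus; apply: y_tower0.
  exact: (@tower_torus 0).
rewrite /= (sbr_jacobi _ _ _ _ _ (y_part j) (x_part i)) addrC.
apply: (@tower_lin k.+1); first by apply: (@tower_x k); apply: IH.
exact: (@tower_torus k.+1).
Qed.

End OneSide.

Variables (x y h : 'I_n -> L) (a b : 'I_n -> 'I_n -> K).
Hypothesis x_part : forall i, x i \in spart (p i).
Hypothesis y_part : forall i, y i \in spart (p i).
Hypothesis h_part : forall i, h i \in spart false.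
Hypothesis h_h : forall i j, [< h i, h j >] = 0.
Hypothesis h_x : forall i j, [< h i, x j >] = a i j *: x j.
Hypothesis h_y : forall i j, [< h i, y j >] = b i j *: y j.
Hypothesis x_y : forall i j, [< x i, y j >] = h i *+ (i == j).

Let ex_h_x j i : exists c, [< h j, x i >] = c *: x i.
Proof. by eexists. Qed.
Let ex_h_y j i : exists c, [< h j, y i >] = c *: y i.
Proof. by eexists. Qed.

Let torus_x_y i j : torus h [< x i, y j >].
Proof.
rewrite x_y; case: eqP => _; first by eexists; apply: (sum1 h i).
by exists (fun=> 0); apply: sum0.
Qed.

Let torus_y_x j i : torus h [< y j, x i >].
Proof.
rewrite (sbr_anti _ _ _ _ (y_part j) (x_part i)) -scaleNr.
by apply: torusZ.
Qed.

(** The index k of a tower stands for k + 1 letters, and [Negz k] is -(k + 1). *)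
Definition layer (m : int) : L -> Prop :=
  match m with
  | Posz 0 => torus h
  | Posz k.+1 => tower x k
  | Negz k => tower y k
  end.

Lemma layer_lin m c u v : layer m u -> layer m v -> layer m (c *: u + v).
Proof.
by case: m => [[|k]|k] /=; [apply: torus_lin|apply: tower_lin|apply: tower_lin].
Qed.

Definition letter_height (t : chevalley n) : int :=
  match t with GenX _ => 1 | GenY _ => -1 | GenH _ => 0 end.

Fixpoint word_height (w : word (chevalley n)) : int :=
  match w with
  | Letter t => letter_height t
  | Node w1 w2 => word_height w1 + word_height w2
  end.

Definition chev (t : chevalley n) : L :=
  match t with GenX i => x i | GenY i => y i | GenH i => h i end.

Lemma chev_part t : chev t \in spart (chevalley_parity p t).
Proof. by case: t => i /=; [apply: x_part|apply: y_part|apply: h_part]. Qed.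

Lemma layer_letter t m v :
  layer m v -> layer (letter_height t + m) [< chev t, v >].
Proof.
case: t => i /=.
- case: m => [[|k]|[|k]] hv.
  + exact: (x_torus x_part h_part).
  + exact: (@tower_x x k).
  + exact: (y_tower0 (x := y)).
  have -> : 1 + Negz k.+1 = Negz k by lia.
  exact: (y_tower y_part x_part h_part).
- case: m => [[|[|k]]|k] hv.
  + exact: (x_torus y_part h_part).
  + exact: (y_tower0 (x := x)).
  + have -> : -1 + k.+2%:Z = k.+1%:Z by lia.
    exact: (y_tower x_part y_part h_part).
  have -> : -1 + Negz k = Negz k.+1 by lia.
  exact: (@tower_x y k).
rewrite add0r; case: m => [[|k]|k] /= hv.
- case: hv => c ->; rewrite raddf_sum; apply: torus_sum => j.
  by rewrite /= sbrZr h_h scaler0; exists (fun=> 0); apply: sum0.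
- exact: (tower_h x_part h_part).
exact: (tower_h y_part h_part).
Qed.

(** As [[a, b], v] = [a, [b, v]] - (-1)^(p(a) p(b)) [b, [a, v]], induction on the left factor leaves
    only brackets with single letters, whatever the bracketing of w. *)
Lemma layer_word w m v :
  layer m v -> layer (word_height w + m) [< weval chev w, v >].
Proof.
elim: w m v => [t|w1 h1 w2 h2] m v hv /=; first exact: layer_letter.
have [p1 p2] := (weval_part chev_part w1, weval_part chev_part w2).
have j := sbr_jacobi _ _ _ _ v p1 p2.
have -> : [< [< weval chev w1, weval chev w2 >], v >] =
   - (-1) ^+ (wparity (chevalley_parity p) w1 && wparity (chevalley_parity p) w2)
     *: [< weval chev w2, [< weval chev w1, v >] >] +
   [< weval chev w1, [< weval chev w2, v >] >].
  by rewrite j scaleNr addrC addrK.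
apply: layer_lin.
  by rewrite (addrC (word_height w1)) -addrA; apply/h2/h1.
by rewrite -addrA; apply/h1/h2.
Qed.

Lemma layer_weval w : layer (word_height w) (weval chev w).
Proof.
elim: w => [[] i /=|w1 _ w2 h2 /=]; last exact: layer_word.
- by eexists; apply: (sum1 x i).
- by eexists; apply: (sum1 y i).
by eexists; apply: (sum1 h i).
Qed.

End Tower.

Section HeightZero.
Variables (K : fieldType) (n : nat) (A : 'M[K]_n) (p : 'I_n -> bool).
Local Notation F := (free_superalg K (chevalley_parity p)).
Local Notation gt := (gtilde A p).
Local Notation tg := (tgen A p).

Lemma tgen_part t : tg t \in spart (chevalley_parity p t).
Proof. by apply/qpartP; eexists; first apply: letter_part. Qed.

Lemma tgen_HH i j : [< tg (GenH i), tg (GenH j) >] = 0.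
Proof.
rewrite -(lpi_sbr (cartan_ideal A p)) cartan_relation //.
exact: RelHH.
Qed.

Lemma tgen_HX i j : [< tg (GenH i), tg (GenX j) >] = A i j *: tg (GenX j).
Proof.
apply/eqP; rewrite -subr_eq0 -(lpi_sbr (cartan_ideal A p)) -lpi_scale -lpiB.
by rewrite cartan_relation //; apply: RelHX.
Qed.

Lemma tgen_HY i j : [< tg (GenH i), tg (GenY j) >] = - A i j *: tg (GenY j).
Proof.
apply/eqP; rewrite scaleNr -addr_eq0 -(lpi_sbr (cartan_ideal A p)) -lpi_scale.
by rewrite -lpiD cartan_relation //; apply: RelHY.
Qed.

Lemma tgen_XY i j : [< tg (GenX i), tg (GenY j) >] = tg (GenH i) *+ (i == j).
Proof.
apply/eqP; rewrite -subr_eq0 -(lpi_sbr (cartan_ideal A p)) -raddfMn -lpiB.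
by rewrite cartan_relation //; apply: RelXY.
Qed.

Lemma lpi_word w : lpi (cartan_ideal A p) (<< w >> : F) = weval (tg : _ -> gt) w.
Proof.
elim: w => [//|w1 h1 w2 h2] /=.
by rewrite -h1 -h2 -[RHS](lpi_sbr (cartan_ideal A p)) free_br_word.
Qed.

Lemma word_heightE (w : word (chevalley n)) :
  word_height w = \sum_i word_degree w 0 i :> int.
Proof.
elim: w => [[] i|w1 h1 w2 h2] /=.
- rewrite (bigD1 i) //= big1 ?mxE ?eqxx // => j /negPf ji.
  by rewrite mxE ji andbF.
- rewrite (bigD1 i) //= big1 ?mxE ?eqxx // => j /negPf ji.
  by rewrite !mxE ji andbF.
- by rewrite big1 // => j _; rewrite mxE.
by rewrite h1 h2 -big_split; apply: eq_bigr => i _; rewrite mxE.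
Qed.

(** The height of a word is the sum of the coordinates of its degree, so a word of degree 0 has
    height 0 and lies in the layer spanned by the h_i. *)
Lemma degree0_cartan (v : gt) : has_degree 0 v -> in_cartan v.
Proof.
move=> [u hu ->]; rewrite -[u]freeg_sumE raddf_sum /= big_seq.
apply: big_ind => [|v1 v2 h1 h2|w].
- by exists (fun=> 0); apply: sum0.
- by rewrite -[v1]scale1r; apply: (@torus_lin _ _ gt (fun i => tg (GenH i))).
rewrite mem_dom => /hu dw.
have -> : << coeff w u *g w >> = coeff w u *: (<< w >> : F).
  by apply/eqP/freeg_eqP => w'; rewrite coeffZ !coeffU mul1r.
rewrite lpi_scale lpi_word.
apply: (@torusZ _ _ gt (fun i => tg (GenH i))).
have := @layer_weval K n p gt (fun i => tg (GenX i)) (fun i => tg (GenY i))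
  (fun i => tg (GenH i)) A (fun i j => - A i j).
move=> /(_ (fun i => tgen_part (GenX i)) (fun i => tgen_part (GenY i))
  (fun i => tgen_part (GenH i)) tgen_HH tgen_HX tgen_HY tgen_XY w).
rewrite word_heightE dw big1 => [|i _]; last by rewrite mxE.
by rewrite (_ : chev _ _ _ = tg) //; apply/funext; case.
Qed.

End HeightZero.

(** * The algebra g(A) and its model *)

Definition chev_index (t : chevalley 2) : nat :=
  match t with GenX i => i | GenY i => (8 + i)%N | GenH i => (16 + i)%N end.

Fixpoint word_form (w : word (chevalley 2)) : sform nat :=
  match w with
  | Letter t => [:: (chev_index t, TP)]
  | Node w1 w2 => tbl2 (word_form w1) (word_form w2)
  end.

Definition basis_word (k : nat) : word (chevalley 2) :=
  let s a b := let ab := Node a b in let bb := Node b b in let bab := Node b ab in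
    [:: a; b; ab; bb; bab; Node ab bb; Node bb bab; Node bab bab] in
  let x1 := Letter (GenX ord0) in let x2 := Letter (GenX ord_max) in
  let y1 := Letter (GenY ord0) in let y2 := Letter (GenY ord_max) in
  nth x1 (s x1 x2 ++ s y1 y2 ++ [:: Node x1 y1; Node x2 y2]) k.

Lemma basis_word_form :
  all_index (fun k => word_form (basis_word k) == [:: (k, TP)]).
Proof. by vm_compute. Qed.

Lemma basis_word_parity :
  all_index (fun k => wparity (chevalley_parity (fun=> true)) (basis_word k)
                  == odd_index k).
Proof. by vm_compute. Qed.

(** The list s gives the roots of x_1, ..., x_8 in terms of the simple roots. For the indices 16 and
    17 the default value (0, 0) is the degree of the h_i. *)
Definition degree_entry (k j : nat) : int :=
  let s := [:: (1, 0); (0, 1); (1, 1); (0, 2); (1, 2); (1, 3); (1, 4); (2, 4)] in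
  let p := nth (0, 0) (s ++ [seq (- q.1, - q.2) | q <- s]) k in
  if j == 0%N then p.1 else p.2.

Definition index_degree (k : nat) : 'rV[int]_2 := \row_j degree_entry k j.

Lemma degree_ok : all_index (fun i => all_index (fun j => all (fun p =>
  all (fun t => degree_entry p.1 t == degree_entry i t + degree_entry j t)
    [:: 0; 1]%N) (tbl i j))).
Proof. by vm_compute. Qed.

Definition opposite (k : nat) : nat := (if k < 8 then k + 8 else k - 8)%N.

(** The last condition says that some Cartan coordinate of the bracket of a vector with the opposite
    of e_k is a nonzero multiple of the k-th coordinate of that vector. The bracket thus detects
    this coordinate. *)
Lemma opposite_ok : all_index (fun k => (k < 16)%N ==>
  [&& (opposite k < 18)%N,
      all (fun t => degree_entry (opposite k) t == - degree_entry k t) [:: 0; 1]%N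
    & has (fun t => ~~ tzero (sconst k (opposite k) t) &&
       all_index (fun m => (m != k) ==> tzero (sconst m (opposite k) t)))
      [:: 16; 17]%N]).
Proof. by vm_compute. Qed.

Section Brj.
Variables (K : fieldType) (charK : 3%N \in [pchar K]).
Local Notation M := (brj_model charK).
Local Notation mb := (mbasis K : nat -> M).
Local Notation A := (brj23_matrix K).
Local Notation p := (fun _ : 'I_2 => true).
Local Notation gt := (gtilde A p).
Local Notation F := (free_superalg K (chevalley_parity p)).
Local Notation g := (brj23 K).

Lemma two_eqN1 : 2 = -1 :> K.
Proof. by apply/eqP; rewrite -addr_eq0 -[2]natr1 (three0 charK). Qed.

Definition mgen (t : chevalley 2) : M := mb (chev_index t).

Lemma mgen_part t : mgen t \in spart (chevalley_parity p t).
Proof.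
have -> : chevalley_parity p t = odd_index (chev_index t).
  by case: t => [] [[|[|//]] hi].
exact: mbasis_part.
Qed.

Lemma mgen_br s t :
  [< mgen s, mgen t >] = seval mb (tbl (chev_index s) (chev_index t)).
Proof. exact: mbr_basis. Qed.

Lemma mgen_HH i j : [< mgen (GenH i), mgen (GenH j) >] = 0.
Proof.
rewrite mgen_br (_ : tbl _ _ = [::]) ?seval0 //.
by case: i j => [[|[|//]] hi] [[|[|//]] hj].
Qed.

Lemma matrixE i j : A i j = tK K (scoef (tbl (16 + i)%N j) j).
Proof.
rewrite mxE; case: i j => [[|[|//]] hi] [[|[|//]] hj] //=.
by rewrite two_eqN1 opprK.
Qed.

Lemma mgen_HX i j : [< mgen (GenH i), mgen (GenX j) >] = A i j *: mgen (GenX j).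
Proof.
rewrite mgen_br matrixE -seval_mono; congr seval.
by case: i j => [[|[|//]] hi] [[|[|//]] hj].
Qed.

Lemma mgen_HY i j : [< mgen (GenH i), mgen (GenY j) >] = - (A i j *: mgen (GenY j)).
Proof.
rewrite mgen_br matrixE -scaleNr -tKN -seval_mono; congr seval.
by case: i j => [[|[|//]] hi] [[|[|//]] hj].
Qed.

Lemma mgen_XY i j : [< mgen (GenX i), mgen (GenY j) >] = mgen (GenH i) *+ (i == j).
Proof.
rewrite mgen_br -[mgen _](seval1 mb).
by case: i j => [[|[|//]] hi] [[|[|//]] hj]; rewrite /= ?seval0.
Qed.

Definition tmodel (q : gt) : M := tlift mgen q.

Lemma tmodel_lpi u : tmodel (lpi (cartan_ideal A p) u) = feval mgen u.
Proof. exact: (tlift_lpi mgen_part mgen_HH mgen_HX mgen_HY mgen_XY). Qed.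

Lemma tmodel_br (u v : gt) : tmodel [< u, v >] = [< tmodel u, tmodel v >].
Proof. exact: (tlift_br mgen_part mgen_HH mgen_HX mgen_HY mgen_XY). Qed.

Lemma tmodel_part b u : u \in spart b -> tmodel u \in spart b.
Proof. exact: (tlift_part mgen_part mgen_HH mgen_HX mgen_HY mgen_XY). Qed.

Lemma tmodel_gen t : tmodel (tgen A p t) = mgen t.
Proof. exact: (tlift_gen mgen_part mgen_HH mgen_HX mgen_HY mgen_XY). Qed.

Fact tmodel_linear : linear tmodel.
Proof. exact: (tlift_linear mgen_part mgen_HH mgen_HX mgen_HY mgen_XY). Qed.
HB.instance Definition _ := GRing.isLinear.Build K gt M *:%R tmodel tmodel_linear.

Lemma weval_form w : weval mgen w = seval mb (word_form w).
Proof.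
elim: w => [t|w1 h1 w2 h2] /=; first by rewrite seval1.
by rewrite h1 h2 (seval_tbl2 charK (model_presentation K)).
Qed.

Lemma weval_basis k : (k < 18)%N -> weval mgen (basis_word k) = mb k.
Proof.
by move=> hk; rewrite weval_form (eqP (all_indexP basis_word_form hk)) seval1.
Qed.

Definition has_mdeg (d : 'rV[int]_2) (v : M) : Prop :=
  forall k, (k < 18)%N -> mcoord k v != 0 -> index_degree k = d.

Lemma mcoordP k c (u v : M) : mcoord k (c *: u + v) = c * mcoord k u + mcoord k v.
Proof. by have [-> _ _ _ _] := model_presentation K. Qed.

Lemma mcoord0 k : mcoord k (0 : M) = 0.
Proof. by have := mcoordP k (-1) 0 0; rewrite scaler0 addr0 mulN1r addNr. Qed.

Lemma mcoord_sum k (I : Type) (r : seq I) (f : I -> M) :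
  mcoord k (\sum_(i <- r) f i) = \sum_(i <- r) mcoord k (f i).
Proof.
apply: (big_morph (mcoord k : M -> K)) => [u v|]; last exact: mcoord0.
by have := mcoordP k 1 u v; rewrite scale1r mul1r.
Qed.

Lemma has_mdeg_lin d c u v :
  has_mdeg d u -> has_mdeg d v -> has_mdeg d (c *: u + v).
Proof.
move=> hu hv k hk; rewrite mcoordP.
have [->|/hu -> //] := eqVneq (mcoord k u) 0.
by rewrite mulr0 add0r; apply: hv.
Qed.

Lemma has_mdeg0 d : has_mdeg d 0.
Proof. by move=> k _; rewrite mcoord0 eqxx. Qed.

Lemma has_mdeg_basis k : (k < 18)%N -> has_mdeg (index_degree k) (mb k).
Proof.
move=> hk l _; rewrite (co_basis (model_presentation K)) //.
by have [->|_] := eqVneq k l; rewrite ?eqxx.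
Qed.

Lemma has_mdeg_ind d (P : M -> Prop) :
  P 0 -> (forall c u v, P u -> P v -> P (c *: u + v)) ->
  (forall k, (k < 18)%N -> index_degree k = d -> P (mb k)) ->
  forall v, has_mdeg d v -> P v.
Proof.
move=> P0 PD Pe v hv; rewrite (co_sum (model_presentation K) v).
apply: big_ind => [//|u w hu hw|i _]; first by rewrite -[u]scale1r; apply: PD.
have [->|/hv h] := eqVneq (mcoord i v) 0; first by rewrite scale0r.
by rewrite -[_ *: _]addr0; apply: PD => //; apply: Pe => //; apply: h.
Qed.

Lemma has_mdeg_seval d (u : sform nat) :
  (forall q, q \in u -> (q.1 < 18)%N /\ index_degree q.1 = d) ->
  has_mdeg d (seval mb u).
Proof.
elim: u => [_|[k c] u IH hu]; first by rewrite seval0; apply: has_mdeg0.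
rewrite seval_cons; apply: has_mdeg_lin.
  by have [hk <-] := hu _ (mem_head _ _); apply: has_mdeg_basis.
by apply: IH => q hq; apply: hu; rewrite inE hq orbT.
Qed.

Lemma has_mdeg_br d1 d2 u v :
  has_mdeg d1 u -> has_mdeg d2 v -> has_mdeg (d1 + d2) [< u, v >].
Proof.
move=> hu hv; move: u hu; apply: has_mdeg_ind => [|c u w hu hw|i hi di].
- by rewrite sbr0l; apply: has_mdeg0.
- by rewrite sbrDl sbrZl; apply: has_mdeg_lin.
move: v hv; apply: has_mdeg_ind => [|c u w hu hw|j hj dj].
- by rewrite raddf0; apply: has_mdeg0.
- by rewrite sbrDr sbrZr; apply: has_mdeg_lin.
rewrite [X in has_mdeg _ X]mbr_basis; apply: has_mdeg_seval => q hq.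
split; first exact: (allP (tbl_keys i j)).
have /allP/(_ _ hq)/allP h := all_indexP (all_indexP degree_ok hi) hj.
rewrite -di -dj; apply/rowP => t; rewrite !mxE; apply/eqP; apply: h.
by case: t => [[|[|//]]].
Qed.

Lemma weval_mdeg w : has_mdeg (word_degree w) (weval mgen w).
Proof.
elim: w => [t|w1 h1 w2 h2] /=; last exact: has_mdeg_br.
have -> : chevalley_degree t = index_degree (chev_index t).
  apply/rowP => j; case: t => [] [[|[|//]] hi];
    by case: j => [[|[|//]] hj]; rewrite !mxE.
by apply: has_mdeg_basis; case: t => [] [[|[|//]] hi].
Qed.

Lemma tmodel_mdeg d u : has_degree d u -> has_mdeg d (tmodel u).
Proof.
move=> [v hv ->]; rewrite tmodel_lpi /feval fgliftE big_seq.
apply: big_ind => [|w1 w2 h1 h2|w]; first exact: has_mdeg0.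
  by rewrite -[w1]scale1r; apply: has_mdeg_lin.
rewrite mem_dom => /hv <-; rewrite -[_ *: _]addr0.
by apply: has_mdeg_lin; [apply: weval_mdeg|apply: has_mdeg0].
Qed.

Lemma tmodel_word w : tmodel (weval (tgen A p) w) = weval mgen w.
Proof. by rewrite -lpi_word tmodel_lpi feval_word scale1r. Qed.

Lemma has_degree_word w : has_degree (word_degree w) (weval (tgen A p) w).
Proof.
exists (<< w >> : F); last by rewrite lpi_word.
move=> w'; rewrite coeffU; have [-> //|_] := eqVneq w w'.
by rewrite mulr0 eqxx.
Qed.

Lemma has_degree_br d1 d2 (u v : gt) :
  has_degree d1 u -> has_degree d2 v -> has_degree (d1 + d2) [< u, v >].
Proof.
move=> [u' hu ->] [v' hv ->]; exists [< u', v' >]; last first.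
  by rewrite (lpi_sbr (cartan_ideal A p)).
move=> w; rewrite (_ : [< u', v' >] = free_br u' v') // /free_br fgliftE.
rewrite raddf_sum /= => /eqP; apply: contra_notP => hw.
rewrite big_seq big1 // => w1; rewrite mem_dom => /hu h1.
rewrite coeffZ fgliftE raddf_sum /= big_seq big1 ?mulr0 // => w2.
rewrite mem_dom => /hv h2; rewrite coeffZ coeffU.
by case: eqP => [e|]; rewrite ?mulr0 //; case: hw; rewrite -e /= h1 h2.
Qed.

Definition tmodel_ker : {pred gt} := [pred u | tmodel u == 0].

Lemma tmodel_kerP u : reflect (tmodel u = 0) (u \in tmodel_ker).
Proof. exact: eqP. Qed.

Lemma tmodel_ker_closed : submod_closed tmodel_ker.
Proof.
split; first by apply/tmodel_kerP; rewrite raddf0.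
move=> c u v /tmodel_kerP hu /tmodel_kerP hv; apply/tmodel_kerP.
by rewrite linearP /= hu hv scaler0 addr0.
Qed.

(** Suppose that the image of a homogeneous u in I has a nonzero coordinate at e_k. If e_k is a root
    vector, the bracket of u with a lift of the opposite root vector has degree 0, so it lies in I
    and in the Cartan subalgebra and is 0, although [opposite_ok] gives it a nonzero image.
    Otherwise u itself has degree 0. *)
Lemma ideal_sub_ker I : avoids_cartan I -> {subset I <= tmodel_ker}.
Proof.
move=> [[[I0 Ilin] Iabs] Igr Icar] v Iv.
have [s [hs ->]] := Igr v Iv.
pose W := Subspace tmodel_ker_closed.
rewrite big_seq; apply: (rpred_sum (S := W)) => u /hs[Iu [d du]].
apply/tmodel_kerP; apply: (coP (model_presentation K)) => k hk; rewrite mcoord0.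
apply/eqP/negP => /negP uk; have dk := tmodel_mdeg du hk uk.
case: (ltnP k 16) => k16.
  have := all_indexP opposite_ok hk; rewrite k16 => /and3P[ho deg].
  move=> /hasP[t tH /andP[nz uniq]].
  pose w := weval (tgen A p : _ -> gt) (basis_word (opposite k)).
  have phiw : tmodel w = mb (opposite k) by rewrite tmodel_word weval_basis.
  (* The degree of the word is read off in the model, where its value is a basis vector of known
     degree. *)
  have dw : word_degree (basis_word (opposite k)) = - d.
    have := weval_mdeg (w := basis_word (opposite k)) ho.
    rewrite weval_basis // (co_basis (model_presentation K)) //.
    rewrite eqxx oner_eq0 => /(_ isT) <-; rewrite -dk.
    apply/rowP => j; rewrite !mxE.
    by apply/eqP/(allP deg); case: j => [[|[|//]]].
  have uw0 : [< u, w >] = 0.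
    apply: Icar; first by have [] := Iabs w u Iu.
    apply: degree0_cartan; rewrite -(subrr d) -dw.
    by apply: has_degree_br => //; apply: has_degree_word.
  have := congr1 tmodel uw0; rewrite tmodel_br phiw raddf0.
  move=> /(congr1 (mcoord t)).
  rewrite (co_brr charK (model_presentation K)) mcoord0 (bigD1 (Ordinal hk)) //=.
  rewrite big1 ?addr0 => [/eqP|i ik].
    by rewrite mulf_eq0 (negPf uk) /= tK_eq0 (negPf nz).
  have := all_indexP uniq (ltn_ord i); rewrite -val_eqE /= in ik.
  by rewrite ik /= -(tK_eq0 K) => /eqP ->; rewrite mulr0.
have d0 : d = 0.
  have k67 : k = 16%N \/ k = 17%N by lia.
  rewrite -dk; apply/rowP => j; rewrite !mxE.
  by case: k67 => ->; case: j => [[|[|//]]].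
move: uk; rewrite (Icar u Iu) ?raddf0 ?mcoord0 ?eqxx //.
by apply: degree0_cartan; rewrite -d0.
Qed.

(** The kernel is graded because the images of components of different degrees have no coordinate in
    common. It meets the Cartan subalgebra trivially because the images of h_1 and h_2 are
    independent. *)
Lemma ker_avoids : avoids_cartan tmodel_ker.
Proof.
split.
- split; first exact: tmodel_ker_closed.
  move=> u v /tmodel_kerP hv; split; apply/tmodel_kerP;
    rewrite tmodel_br hv ?raddf0 //.
  exact: sbr0l.
- move=> v /tmodel_kerP hv.
  (* The homogeneous components of v are obtained from a representative in the free algebra by
     collecting its words by degree. *)
  pose u : F := repr v.
  pose part d : F := \sum_(w <- dom u | word_degree w == d) << coeff w u *g w >>.
  pose ds := undup [seq word_degree w | w <- dom u].
  have part_deg d : has_degree d (lpi (cartan_ideal A p) (part d)).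
    exists (part d) => // w; rewrite /part raddf_sum /= => /eqP.
    apply: contra_notP => hw; rewrite big1 // => w' /eqP dw; rewrite coeffU.
    by case: eqP => [e|]; rewrite ?mulr0 //; case: hw; rewrite -e.
  have u_sum : u = \sum_(d <- ds) part d.
    rewrite -{1}[u]freeg_sumE /part (exchange_big_dep predT) //=.
    rewrite big_seq [RHS]big_seq.
    apply: eq_bigr => w hw; rewrite -big_filter.
    rewrite (perm_big [:: word_degree w]) ?big_seq1 //.
    apply: uniq_perm => // [|d]; first by rewrite filter_uniq ?undup_uniq.
    rewrite mem_filter inE mem_undup eq_sym; case: eqP => // ->.
    by rewrite map_f.
  exists [seq lpi (cartan_ideal A p) (part d) | d <- ds]; split; last first.
    rewrite big_map -raddf_sum -u_sum; exact/esym/lpi_surj.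
  move=> _ /mapP[d hd ->]; split; last by exists d.
  (* A nonzero k-th coordinate in the image of the component of degree d forces d to be the degree
     of e_k. No other component contributes to that coordinate, which would then be nonzero in the
     image of v as well. *)
  apply/tmodel_kerP; apply: (coP (model_presentation K)) => k hk.
  rewrite mcoord0; apply/eqP/negP => /negP nz.
  have dk := tmodel_mdeg (part_deg d) hk nz.
  move: hv; rewrite -[v]lpi_surj -/u u_sum raddf_sum raddf_sum.
  move=> /(congr1 (mcoord k)).
  rewrite mcoord0 mcoord_sum /= (bigD1_seq d) ?undup_uniq //= big1 => [/eqP|d' d'd].
    by rewrite addr0 (negPf nz).
  apply/eqP/negP => /negP /(tmodel_mdeg (part_deg d') hk).
  by rewrite dk => /esym/eqP; rewrite (negPf d'd).
move=> v /tmodel_kerP hv [c ev]; move: hv; rewrite ev raddf_sum => h.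
apply: big1 => j _; suff -> : c j = 0 by rewrite scale0r.
have := congr1 (mcoord (16 + j)) h; rewrite mcoord0 mcoord_sum (bigD1 j) //=.
have cE i : mcoord (16 + j) (tmodel (c i *: tgen A p (GenH i))) = c i * (i == j)%:R.
  rewrite linearZ /= tmodel_gen -[_ *: _]addr0 mcoordP mcoord0 addr0.
  rewrite (co_basis (model_presentation K)) ?eqn_add2l //.
  by case: i => [[|[|//]]].
rewrite cE eqxx mulr1 big1 ?addr0 // => i /negPf ij.
by rewrite cE ij mulr0.
Qed.

Lemma max_idealE u : (u \in max_superideal A p) = (tmodel u == 0).
Proof.
apply/idP/eqP => [hu|hu]; last first.
  by apply: (max_ideal_sub ker_avoids); apply/tmodel_kerP.
apply/tmodel_kerP; move/max_idealP: hu; apply.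
  exact: tmodel_ker_closed.
exact: ideal_sub_ker.
Qed.

Definition gmodel (x : g) : M := tmodel (repr x).

Lemma gmodel_lpi u : gmodel (lpi (max_superideal A p) u) = tmodel u.
Proof.
apply/eqP; rewrite /gmodel -subr_eq0 -raddfB /= -max_idealE.
by apply/lpi_eq; rewrite lpi_surj.
Qed.

Fact gmodel_linear : linear gmodel.
Proof.
move=> c u v; rewrite -[u]lpi_surj -[v]lpi_surj -linearP !gmodel_lpi.
exact: linearP.
Qed.
HB.instance Definition _ := GRing.isLinear.Build K g M *:%R gmodel gmodel_linear.

Lemma gmodel_br (u v : g) : gmodel [< u, v >] = [< gmodel u, gmodel v >].
Proof.
rewrite -[u]lpi_surj -[v]lpi_surj -(lpi_sbr (max_superideal A p)) !gmodel_lpi.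
exact: tmodel_br.
Qed.

Lemma gmodel_part b u : u \in spart b -> gmodel u \in spart b.
Proof. by move=> /qpartP[v hv ->]; rewrite gmodel_lpi tmodel_part. Qed.

Lemma gmodel_inj : injective gmodel.
Proof.
move=> u v; rewrite -[u]lpi_surj -[v]lpi_surj !gmodel_lpi => h.
by apply/lpi_eq; rewrite max_idealE raddfB /= h subrr.
Qed.

Definition brj_basis : seq g :=
  [seq brj23_x K k | k <- iota 1 8] ++ [seq brj23_y K k | k <- iota 1 8]
  ++ [seq brj23_h K k | k <- iota 1 2].

Lemma brj_basis_word k : (k < 18)%N ->
  brj_basis`_k =
    lpi (max_superideal A p) (weval (tgen A p : _ -> gt) (basis_word k)).
Proof.
have lpiE w : lpi (max_superideal A p) (weval (tgen A p : _ -> gt) w)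
    = weval (cgen A p : _ -> g) w.
  elim: w => [//|w1 h1 w2 h2] /=; rewrite (lpi_sbr (max_superideal A p)).
  by rewrite h1 h2.
rewrite lpiE.
by do 18![case: k => [//|k]].
Qed.

Lemma gmodel_basis k : gmodel brj_basis`_k = mb k.
Proof.
case: (ltnP k 18) => hk.
  by rewrite brj_basis_word // gmodel_lpi tmodel_word weval_basis.
by rewrite nth_default // raddf0 mbasis_out.
Qed.

Definition brj_coord (k : nat) (x : g) : K := mcoord k (gmodel x).

(** [max_idealE] makes [gmodel] injective, and it sends the named elements to the basis of M; the
    structure of M is pulled back along it. *)
Lemma brj_presentation : presentation (fun k => brj_basis`_k) brj_coord.
Proof.
have [m_lin m_basis m_sum m_part m_br] := model_presentation K.
have sumE x : x = \sum_(i < 18) brj_coord i x *: brj_basis`_i.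
  apply: gmodel_inj; rewrite {1}[gmodel x]m_sum raddf_sum.
  apply: eq_bigr => i _ /=.
  by rewrite linearZ /= gmodel_basis.
split=> //.
- by move=> k c u v; rewrite /brj_coord linearP; apply: m_lin.
- by move=> i k hi; rewrite /brj_coord gmodel_basis m_basis.
- move=> a x; split => [/gmodel_part/m_part //|h].
  rewrite (sumE x); apply: rpred_sum => i _.
  have [->|/h <-] := eqVneq (brj_coord i x) 0; rewrite ?scale0r ?rpred0 ?ltn_ord //.
  apply: rpredZ; rewrite brj_basis_word ?ltn_ord //; apply/qpartP; eexists => //.
  rewrite -(eqP (all_indexP basis_word_parity (ltn_ord i))).
  exact: (weval_part (tgen_part A p)).
move=> i j; apply: gmodel_inj; rewrite gmodel_br !gmodel_basis.
rewrite [LHS]m_br /seval raddf_sum; apply: eq_bigr => q _ /=.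
by rewrite linearZ /= gmodel_basis.
Qed.

End Brj.

(** * Derivations and 2-cocycles *)

Section Cohomology.
Variables (K : fieldType) (charK : 3%N \in [pchar K]) (L : lieSuperType K).
Variables (e : nat -> L) (co : nat -> L -> K).
Hypothesis pres : presentation e co.
Let basis_part := basis_part pres.
Let basis_ind := basis_ind pres.
Let part_ind := part_ind pres.
Let co_sum := co_sum pres.

Lemma co_lin k c u v : co k (c *: u + v) = c * co k u + co k v.
Proof. by case: pres. Qed.

Lemma co0 k : co k 0 = 0.
Proof. by have := co_lin k (-1) 0 0; rewrite scaler0 addr0 mulN1r addNr. Qed.

Lemma coD k u v : co k (u + v) = co k u + co k v.
Proof. by have := co_lin k 1 u v; rewrite scale1r mul1r. Qed.

Lemma coZ k c u : co k (c *: u) = c * co k u.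
Proof. by have := co_lin k c u 0; rewrite co0 !addr0. Qed.

Lemma co_br2 i j k : co k [< e i, e j >] = tK K (sconst i j k).
Proof. by rewrite (co_br pres) (co_seval charK pres) ?tbl_keys. Qed.

Lemma linear_sum (V : lmodType K) (h : L -> V) x : linear h ->
  h x = \sum_(i < 18) co i x *: h (e i).
Proof.
move=> hl; have hD u v : h (u + v) = h u + h v.
  by have := hl 1 u v; rewrite !scale1r.
have h0 : h 0 = 0 by apply: (addrI (h 0)); rewrite -hD !addr0.
rewrite {1}(co_sum x) (big_morph h hD h0); apply: eq_bigr => i _.
by have := hl (co i x) (e i) 0; rewrite h0 !addr0.
Qed.

Lemma linear_ext (V : lmodType K) (h h' : L -> V) : linear h -> linear h' ->
  (forall i, (i < 18)%N -> h (e i) = h' (e i)) -> forall x, h x = h' x.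
Proof.
move=> hl hl' E x; rewrite (linear_sum x hl) (linear_sum x hl').
by apply: eq_bigr => i _; rewrite E.
Qed.

Definition table_map (f : nat -> sform nat) (x : L) : L :=
  \sum_(i < 18) co i x *: seval e (f i).

Lemma table_map_linear f : linear (table_map f).
Proof.
move=> c u v; rewrite /table_map scaler_sumr -big_split; apply: eq_bigr => i _ /=.
by rewrite co_lin scalerDl scalerA.
Qed.

Lemma table_map_basis f i : (i < 18)%N -> table_map f (e i) = seval e (f i).
Proof.
move=> hi; rewrite /table_map (bigD1 (Ordinal hi)) //= big1 => [|j].
  by rewrite (co_basis pres) // eqxx scale1r addr0.
rewrite -val_eqE /= eq_sym => /negPf ij.
by rewrite (co_basis pres) // ij scale0r.
Qed.

Lemma table_map_seval f u : all (fun p => p.1 < 18)%N u ->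
  table_map f (seval e u) = seval e (smap f u).
Proof.
move/allP => hu; rewrite (seval_smap charK) /seval.
have lf := table_map_linear f; have f0 : table_map f 0 = 0.
  by rewrite /table_map big1 // => i _; rewrite co0 scale0r.
have fD u1 u2 : table_map f (u1 + u2) = table_map f u1 + table_map f u2.
  by rewrite -[u1]scale1r lf !scale1r.
rewrite (big_morph _ fD f0) big_seq [RHS]big_seq; apply: eq_bigr => p /hu hp.
by rewrite -[_ *: _]addr0 lf f0 addr0 table_map_basis.
Qed.

Lemma seval_part b (u : sform nat) :
  all (fun p => (p.1 < 18)%N && (odd_index p.1 == b)) u -> seval e u \in spart b.
Proof.
move/allP => h; rewrite /seval big_seq; apply: rpred_sum => p /h/andP[hp /eqP <-].
by apply: rpredZ; apply: basis_part.
Qed.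

Lemma table_map_part a b f : (forall i, (i < 18)%N -> odd_index i = a ->
    seval e (f i) \in spart b) ->
  forall x, x \in spart a -> table_map f x \in spart b.
Proof.
move=> hf; apply: part_ind => [|c u v hu hv|i hi pi].
- rewrite (_ : table_map f 0 = 0) ?rpred0 //.
  by rewrite /table_map big1 // => i _; rewrite co0 scale0r.
- by rewrite table_map_linear rpredD ?rpredZ.
by rewrite table_map_basis //; apply: hf.
Qed.

Lemma table_automorphism f f' : all_index (sym_check f) ->
  all_index (fun i => (smap f' (f i) == [:: (i, TP)]) &&
                      (smap f (f' i) == [:: (i, TP)])) ->
  all_index (sym_check f') ->
  [/\ is_automorphism (table_map f), cancel (table_map f) (table_map f')
    & cancel (table_map f') (table_map f)].
Proof.
move=> fs ff fs'.
have keys h i : all_index (sym_check h) -> (i < 18)%N ->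
    all (fun p => p.1 < 18)%N (h i).
  move=> hs hi; have /andP[/allP hh _] := all_indexP hs hi.
  by apply/allP => p /hh/andP[].
have can h h' : all_index (sym_check h) ->
    (forall i, (i < 18)%N -> smap h' (h i) = [:: (i, TP)]) ->
    cancel (table_map h) (table_map h').
  move=> hs hh; apply: linear_ext => [c u v|c u v|i hi];
    rewrite ?table_map_linear //.
  by rewrite table_map_basis // table_map_seval ?keys // hh ?seval1.
have c1 : cancel (table_map f) (table_map f').
  by apply: can => // i /(all_indexP ff)/andP[/eqP].
have c2 : cancel (table_map f') (table_map f).
  by apply: can => // i /(all_indexP ff)/andP[_ /eqP].
split=> //; split.
- by exists (table_map f').
- exact: table_map_linear.
- move=> a; apply: table_map_part => i hi <-.
  by have /andP[hp _] := all_indexP fs hi; apply: seval_part.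
move=> x y; move: x.
apply: (@linear_ext L (fun x => table_map f [< x, y >])) => [c u v|c u v|i hi].
- by rewrite sbrDl sbrZl table_map_linear.
- by rewrite table_map_linear sbrDl sbrZl.
move: y; apply: (@linear_ext L (fun y => table_map f [< e i, y >])) =>
  [c u v|c u v|j hj].
- by rewrite sbrDr sbrZr table_map_linear.
- by rewrite table_map_linear sbrDr sbrZr.
rewrite (co_br pres) table_map_seval ?tbl_keys // !table_map_basis //.
rewrite (seval_tbl2 charK pres).
have /andP[_ h] := all_indexP fs hi; have /nilP := all_indexP h hj.
move/(congr1 (seval e)); rewrite seval_add // scaleN1r addrC seval0.
by move/subr0_eq.
Qed.

Lemma table_derivation f :
  all_index (der_check f) -> is_derivation true (table_map f).
Proof.
move=> fs; split; first exact: table_map_linear.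
  move=> a; apply: table_map_part => i hi <-.
  by have /andP[hp _] := all_indexP fs hi; apply: seval_part.
move=> a x y hx; move: y.
apply: (@linear_ext L (fun y => table_map f [< x, y >])) => [c u v|c u v|j hj].
- by rewrite sbrDr sbrZr table_map_linear.
- rewrite table_map_linear !sbrDr !sbrZr !scalerDr !scalerA mulrC -!addrA.
  by congr (_ + _); rewrite addrCA.
move: x hx; apply: part_ind => [|c u v hu hv|i hi pi].
- rewrite sbr0l !(linear_sum 0 (table_map_linear f)) !big1 => [|i _];
    by rewrite ?sbr0l ?scaler0 ?addr0 // co0 scale0r.
- rewrite !(sbrDl, sbrZl) !table_map_linear hu hv !(sbrDl, sbrZl).
  rewrite !scalerDr !scalerA.
  by rewrite mulrC addrACA.
rewrite (co_br pres) table_map_seval ?tbl_keys // !table_map_basis //.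
rewrite (seval_tbll charK pres) (seval_tblr charK pres) -pi.
have /andP[_ h] := all_indexP fs hi; have /nilP := all_indexP h hj.
move/(congr1 (seval e)); rewrite !seval_add // scaleN1r addrC seval0 addr0.
by rewrite scale1r tK_sign => /subr0_eq.
Qed.

Lemma conj_derivation b (D s t : L -> L) : is_automorphism s -> is_automorphism t ->
  cancel t s -> is_derivation b D -> is_derivation b (s \o D \o t).
Proof.
move=> [_ sl sp sm] [_ tl tp tm] ts [dl dp dd]; split=> [c u v|a x hx|a x y hx] /=.
- by rewrite tl dl sl.
- by apply/sp/dp/tp.
by rewrite tm (dd _ _ _ (tp _ _ hx)) addrC sl !sm !ts addrC.
Qed.

Section Derivation.
Variables D0 D1 : L -> L.
Hypothesis d0 : is_derivation false D0.
Hypothesis d1 : is_derivation true D1.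
Let D := D0 + D1.
Definition entry (q : key) : K^o := co q.2 (D (e q.1)).

(** If the last coordinate is nonzero, then p(l) = p(i) + b + p(j), so the Leibniz sign (-1)^(b
    p(i)) can be written without b; if it is zero, any sign will do. The even and odd parts of D can
    then be added. *)
Lemma der_entry b E i j l :
  is_derivation b E -> (i < 18)%N -> (j < 18)%N -> (l < 18)%N ->
  co l (E [< e i, e j >]) = co l [< E (e i), e j >] +
   (-1) ^+ ((odd_index i (+) odd_index j (+) odd_index l) && odd_index i)
     * co l [< e i, E (e j) >].
Proof.
move=> [_ ep ed] hi hj hl; rewrite (ed _ _ _ (basis_part hi)) coD coZ.
have [->|nz] := eqVneq (co l [< e i, E (e j) >]) 0; first by rewrite !mulr0.
have := spart_br _ _ _ _ (basis_part hi) (ep _ _ (basis_part hj)).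
move/(co_part pres)/(_ l hl nz) => ->; congr (_ + (-1) ^+ (_ && _) * _).
by clear ep ed; case: (odd_index i); case: (odd_index j); case: b.
Qed.

Lemma DE x : D x = D0 x + D1 x.
Proof. by []. Qed.

Lemma D_linear : linear D.
Proof.
case: d0 d1 => l0 _ _ [l1 _ _] c u v; rewrite !DE l0 l1 scalerDr.
by rewrite addrACA.
Qed.

Lemma der_eqn_entry i j l : (i < 18)%N -> (j < 18)%N -> (l < 18)%N ->
  seval entry (der_eqn i j l) = 0.
Proof.
move=> hi hj hl; rewrite /der_eqn !seval_add // !seval_iota seval0 addr0 scale1r.
rewrite tKN tK_sign scaleN1r scaleNr /entry /=.
set A := \sum_(k < 18) _; set B := \sum_(k < 18) _; set C := \sum_(k < 18) _.
have -> : A = co l (D [< e i, e j >]).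
  rewrite (linear_sum _ D_linear) /A.
  rewrite (big_morph (co l) (coD l) (co0 l)); apply: eq_bigr => k _.
  by rewrite coZ co_br2.
have -> : B = co l [< D (e i), e j >].
  by rewrite (co_brr charK pres); apply: eq_bigr => k _; rewrite mulrC.
have -> : C = co l [< e i, D (e j) >].
  by rewrite (co_brl charK pres); apply: eq_bigr => k _; rewrite mulrC.
rewrite !DE sbrDl sbrDr !coD (der_entry d0) // (der_entry d1) //.
by rewrite /GRing.scale /=; ring.
Qed.

(** The equations [der_eqn_entry] imply, through [der_ok], that every [der_target] vanishes; this is
    the identity in coordinates. *)
Lemma derivation_combination : exists (u : L) (a b : K),
  forall x, 
    D x = [< u, x >] + a *: table_map outer_table x
          + b *: table_map conj_outer_table x.
Proof.
pose lam k := seval entry (inner_form k) : K.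
exists (\sum_(k < 18) lam k *: e k), (- entry (1, 11)%N), (- entry (9, 3)%N).
apply: linear_ext => [|c u v|i hi]; first exact: D_linear.
  rewrite sbrDr sbrZr !table_map_linear !scalerDr !scalerA.
  by rewrite !(mulrC c) (AC (2*2*2) ((1*3*5)*(2*4*6)))%AC.
apply: (coP pres) => l hl.
have: seval entry (der_target i l) = 0.
  apply: (entailsP charK der_ok); last first.
    apply/mapP; exists (i, l) => //.
    by apply/allpairsP; exists (i, l); rewrite !mem_iota.
  move=> _ /mapP[[k [j m]] + ->].
  move=> /allpairsP[[k' [j' m']] [hk hp /= [-> -> ->]]]; move: hp.
  move=> /allpairsP[[j'' m''] [hj hm /= [-> ->]]].
  move: hj hm; rewrite !mem_iota => /= hj hm; apply: der_eqn_entry => //.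
  by move: hk; rewrite !inE => /or4P[] /eqP /= ->.
rewrite /der_target 3!(seval_add charK) !seval1 (seval_smap charK) sum_iota.
rewrite !tKN /= scaleN1r addrC => /subr0_eq H.
rewrite -[LHS]/(entry (i, l)) -H.
rewrite !coD !coZ !table_map_basis // !(co_seval charK pres);
  rewrite ?(all_indexP conj_outer_table_keys) ?(all_indexP outer_table_keys) //.
rewrite sbr_suml (big_morph (co l) (coD l) (co0 l)) [RHS]addrC addrA [RHS]addrC.
rewrite /GRing.scale /=.
set A := \sum_(k < 18) _; set B := \sum_(k < 18) _.
have -> : A = B.
  by apply: eq_bigr => k _; rewrite sbrZl coZ co_br2 mulrC.
by ring.
Qed.

End Derivation.

(** * The two outer derivations and H^1 *)

Section Outer.
Local Notation th := (table_map theta_table).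
Local Notation thV := (table_map theta_inv_table).

Definition outer1 : L -> L := table_map outer_table.
Definition outer2 : L -> L := th \o outer1 \o thV.

Lemma theta_automorphism : [/\ is_automorphism th, cancel th thV & cancel thV th].
Proof. exact: (table_automorphism theta_ok theta_cancel theta_inv_ok). Qed.

Lemma thetaV_automorphism : is_automorphism thV.
Proof.
suff h : all_index (fun i =>
    (smap theta_table (theta_inv_table i) == [:: (i, TP)]) &&
    (smap theta_inv_table (theta_table i) == [:: (i, TP)])).
  by have [] := table_automorphism theta_inv_ok h theta_ok.
by apply/allP => i /(allP theta_cancel); rewrite andbC.
Qed.

Lemma outer1_derivation : is_derivation true outer1.
Proof. exact: (table_derivation outer_table_ok). Qed.

Lemma outer2_derivation : is_derivation true outer2.
Proof.
have [h1 _ h2] := theta_automorphism.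
exact: conj_derivation h1 thetaV_automorphism h2 outer1_derivation.
Qed.

Lemma outer2E x : outer2 x = table_map conj_outer_table x.
Proof.
move: x; apply: linear_ext => [||i hi]; try exact: table_map_linear.
  by case: outer2_derivation.
have keys f j : all_index (sym_check f) -> (j < 18)%N ->
    all (fun p => p.1 < 18)%N (f j).
  move=> hf hj; have /andP[/allP h _] := all_indexP hf hj.
  by apply/allP => p /h/andP[].
rewrite /outer2 /outer1 /= !table_map_basis // table_map_seval; last first.
  exact: keys theta_inv_ok hi.
by rewrite table_map_seval //; apply: (all_indexP outer_theta_inv_keys hi).
Qed.

(** At x_2 to y_4 the first outer derivation has component -1 and the second 0; at y_2 to x_4 it is
    the other way round. By [outer_ok] the inner derivation has neither component. *)
Lemma outer_independent a b u :
  (forall x, a *: outer1 x + b *: outer2 x = [< u, x >]) -> a = 0 /\ b = 0.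
Proof.
move=> h.
have co_in i l : (i < 18)%N ->
    (forall k, (k < 18)%N -> tzero (sconst k i l)) ->
    co l (a *: outer1 (e i) + b *: outer2 (e i)) = 0.
  move=> hi hz; rewrite h (co_brr charK pres) big1 // => k _.
  by have := hz k (ltn_ord k); rewrite -(tK_eq0 K) => /eqP ->; rewrite mulr0.
have h1 := co_in 1%N 11%N isT (fun k hk => proj1 (andP (all_indexP outer_ok hk))).
have h2 := co_in 9%N 3%N isT (fun k hk => proj2 (andP (all_indexP outer_ok hk))).
move: h1 h2; rewrite !outer2E /outer1 !coD !coZ !table_map_basis //.
rewrite !(co_seval charK pres) //= ?mulr0 ?addr0 ?add0r ?mulrN1.
by move=> /eqP; rewrite oppr_eq0 => /eqP -> /eqP; rewrite oppr_eq0 => /eqP ->.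
Qed.

Lemma der_mem (D : L -> L) : is_derivation true D -> D \in derivation (g := L).
Proof.
move=> hD; rewrite inE; apply/asboolP; exists 0, D.
by split=> //; [apply: is_derivation0|rewrite add0r].
Qed.

Definition outer1_der : der L := exist _ outer1 (der_mem outer1_derivation).
Definition outer2_der : der L := exist _ outer2 (der_mem outer2_derivation).

Lemma H1_class_eq (D E : der L) :
  H1_class D = H1_class E <-> exists u, forall x, val D x - val E x = [< u, x >].
Proof.
rewrite /H1_class; split=> [/lpi_eq|[u hu]].
  rewrite inE /= inE => /asboolP[u hu]; exists u => x.
  by rewrite -hu.
apply/lpi_eq; rewrite inE /= inE; apply/asboolP; exists u.
by apply/funext.
Qed.

Lemma H1_basis : is_basis [:: H1_class outer1_der; H1_class outer2_der].
Proof.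
have sumE (c : 'I_2 -> K) :
    \sum_(i < 2) c i *: [:: H1_class outer1_der; H1_class outer2_der]`_i
    = H1_class (c ord0 *: outer1_der + c ord_max *: outer2_der).
  rewrite big_ord_recl big_ord1 /= /H1_class raddfD /= !linearZ /=.
  by congr (_ + c _ *: _); apply: val_inj.
split=> [c h0|q].
  have h : H1_class (c ord0 *: outer1_der + c ord_max *: outer2_der) = 0.
    by rewrite -(sumE c).
  have : H1_class (c ord0 *: outer1_der + c ord_max *: outer2_der) = H1_class 0.
    by rewrite h /H1_class raddf0.
  move=> /H1_class_eq[u hu].
  have [x|c0 c1] := @outer_independent (c ord0) (c ord_max) u.
    rewrite -hu (_ : val (0 : der L) x = 0) // subr0.
    by [].
  by case=> [[|[|//]] hi]; [rewrite -[RHS]c0|rewrite -[RHS]c1];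
    congr (c _); apply: val_inj.
have [D ->] : exists D : der L, q = H1_class D.
  by exists (repr q); rewrite /H1_class lpi_surj.
have := valP D; rewrite inE => /asboolP[D0 [D1 [d0 d1 eD]]].
have [u [a [b ab]]] := derivation_combination d0 d1.
exists (fun i : 'I_2 => if i == ord0 then a else b).
rewrite [RHS](sumE _) /=; apply/H1_class_eq; exists u => x.
rewrite eD /= ab -outer2E.
rewrite -[X in _ - X]/(a *: outer1 x + b *: outer2 x).
rewrite -[table_map outer_table x]/(outer1 x).
by rewrite -[_ + _ + b *: _]addrA addrK.
Qed.
End Outer.

(** * 2-cocycles and H^2 *)

Section Cocycle.
Variable om : L -> L -> K^o.
Hypothesis om_cocycle : om \in cocycle2 (g := L).

Definition om_entry (q : key) : K^o := om (e q.1) (e q.2).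

Let om_linl y : linear (om^~ y).
Proof. by move: om_cocycle; rewrite inE => /asboolP[[h _] _ _ _]; apply: h. Qed.
Let om_linr x : linear (om x).
Proof. by move: om_cocycle; rewrite inE => /asboolP[[_ h] _ _ _]; apply: h. Qed.

Lemma om_brl i j y : om [< e i, e j >] y =
  \sum_(l < 18) tK K (sconst i j l) *: om (e l) y.
Proof.
rewrite (linear_sum _ (om_linl y)); apply: eq_bigr => l _.
by rewrite co_br2.
Qed.

Lemma om_brr i j x : om x [< e i, e j >] =
  \sum_(l < 18) tK K (sconst i j l) *: om x (e l).
Proof.
rewrite (linear_sum _ (om_linr x)); apply: eq_bigr => l _.
by rewrite co_br2.
Qed.

Lemma coc_eqns_entry u : u \in coc_eqns -> seval om_entry u = 0.
Proof.
move: om_cocycle; rewrite inE => /asboolP[_ anti coc cube].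
rewrite /coc_eqns !mem_cat => /or3P[] /mapP.
- move=> [[i j] /allpairsP[[i' j'] [+ + /= [-> ->]]] ->] /=.
  rewrite !mem_iota => /= hi hj; rewrite /anti_eqn !(seval_add charK).
  rewrite !seval1 seval0 addr0 scale1r tK_sign /om_entry /=.
  by rewrite (anti _ _ _ _ (basis_part hi) (basis_part hj)) addNr.
- move=> [i + ->]; rewrite mem_iota => /= hi; rewrite /cube_eqn.
  case: ifP => [oi|_]; last exact: seval0.
  rewrite (seval_add charK) seval_iota seval0 addr0 scale1r /om_entry /= -om_brr.
  by apply: cube; rewrite -oi; apply: basis_part.
move=> [[i [j k]] /allpairsP[[i' [j' k']] [hi hp /= [-> -> ->]]] ->]; move: hp.
move=> /allpairsP[[j'' k''] [hj hk /= [-> ->]]].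
move: hj hk; rewrite !mem_iota => /= hj hk.
have {}hi : (i' < 18)%N by move: hi; rewrite !inE => /or4P[] /eqP /= ->.
rewrite /cocycle_eqn !(seval_add charK) !seval_iota seval0 addr0 scale1r tK_sign.
rewrite scaleN1r /om_entry /= -om_brl -!om_brr.
rewrite (coc _ _ _ _ _ (basis_part hi) (basis_part hj)).
by rewrite /GRing.scale /=; ring.
Qed.

(** By bilinearity it suffices to compare both sides on pairs of basis vectors, where the equality
    is the vanishing of [coc_target]. *)
Lemma cocycle_coboundary : om \in coboundary2 (g := L).
Proof.
rewrite inE; apply/asboolP.
pose lam k := seval om_entry (cob_form k).
exists (fun x => \sum_(k < 18) co k x *: lam k) => [c u v|].
  rewrite scaler_sumr -big_split; apply: eq_bigr => k _ /=.
  by rewrite co_lin scalerDl scalerA.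
have fl : linear (fun x => \sum_(k < 18) co k x *: lam k).
  move=> c u v; rewrite scaler_sumr -big_split; apply: eq_bigr => k _ /=.
  by rewrite co_lin scalerDl scalerA.
apply/funext => x; apply/funext => y; move: x.
apply: (@linear_ext K^o (om^~ y)) => [|c u v|i hi]; first exact: om_linl.
  by rewrite sbrDl sbrZl fl.
move: y; apply: (@linear_ext K^o (om (e i))) => [|c u v|j hj]; first exact: om_linr.
  by rewrite sbrDr sbrZr fl.
have: seval om_entry (coc_target i j) = 0.
  apply: (entailsP charK coc_ok coc_eqns_entry).
  apply/mapP; exists (i, j) => //.
  by apply/allpairsP; exists (i, j); rewrite !mem_iota.
rewrite /coc_target (seval_add charK) seval1 (seval_smap charK) sum_iota scaleN1r.
rewrite addrC => /subr0_eq H; rewrite -[LHS]/(om_entry (i, j)) -H.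
by apply: eq_bigr => k _; rewrite co_br2.
Qed.

End Cocycle.

Lemma H2_zero (c : H2 L) : c = 0.
Proof.
rewrite -[c]lpi_surj -(raddf0 (lpi _)); apply/lpi_eq; rewrite subr0 inE.
exact: (cocycle_coboundary (valP (repr c))).
Qed.

End Cohomology.

(** * The named basis and the values of D and theta on it *)

Lemma brj_is_basis (K : fieldType) (charK : 3%N \in [pchar K]) :
  is_basis (brj_basis K).
Proof.
have pres := brj_presentation charK.
split=> [c h i|v]; last first.
  by exists (fun i => brj_coord charK i v); apply: (co_sum pres).
have /(congr1 (brj_coord charK i)) := h.
rewrite (co0 pres) (big_morph _ (coD pres i) (co0 pres i)) (bigD1 i) //=.
rewrite big1 => [|j].
  by rewrite addr0 (coZ pres) (co_basis pres) ?ltn_ord // eqxx mulr1.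
rewrite -val_eqE /= => /negPf ji.
by rewrite (coZ pres) (co_basis pres) ?ltn_ord // ji mulr0.
Qed.

Lemma brj_basis_x (K : fieldType) k : (k < 8)%N ->
  (brj_basis K)`_k = brj23_x K k.+1.
Proof. by do 8![case: k => [//|k]]. Qed.

Lemma brj_basis_y (K : fieldType) k : (k < 8)%N ->
  (brj_basis K)`_(8 + k) = brj23_y K k.+1.
Proof. by do 8![case: k => [//|k]]. Qed.

Lemma brj_basis_h (K : fieldType) k : (k < 2)%N ->
  (brj_basis K)`_(16 + k) = brj23_h K k.+1.
Proof. by do 2![case: k => [//|k]]. Qed.

Section Values.
Variables (K : fieldType) (charK : 3%N \in [pchar K]) (L : lieSuperType K).
Variables (e : nat -> L) (co : nat -> L -> K).
Hypothesis pres : presentation e co.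
Variables (x y h : nat -> L).
Hypothesis xE : forall k, (k < 8)%N -> e k = x k.+1.
Hypothesis yE : forall k, (k < 8)%N -> e (8 + k)%N = y k.+1.
Hypothesis hE : forall k, (k < 2)%N -> e (16 + k)%N = h k.+1.

Lemma table_map_values f (z : nat -> L) m n : (m + n <= 18)%N ->
    (forall k, (k < n)%N -> e (m + k)%N = z k.+1) ->
  [seq table_map e co f (z k) | k <- iota 1 n] =
  [seq seval e (f k) | k <- iota m n].
Proof.
(* The named elements are counted from 1 and the basis indices from m; both ranges are shifted to
   start at 0. *)
move=> mn zE; rewrite -[1%N]addn0 -[in RHS](addn0 m) !iotaDl -!map_comp.
apply/eq_in_map => k; rewrite mem_iota => /= kn.
rewrite add1n -zE // (table_map_basis pres) //.
by apply: leq_trans mn; rewrite -addnS leq_add2l.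
Qed.

Lemma seval_neg k : seval e [:: (k, TM)] = - e k.
Proof. by rewrite seval_cons seval0 addr0 scaleN1r. Qed.

Lemma outer1_values :
  [/\ [seq outer1 e co (x k) | k <- iota 1 8] =
         [:: 0; - y 4%N; 0; 2 *: y 2%N; 0; x 1%N; - x 3%N; 0],
      [seq outer1 e co (y k) | k <- iota 1 8] =
         [:: -2 *: y 6%N; 0; y 7%N; 0; 0; 0; 0; 0]
    & [seq outer1 e co (h k) | k <- iota 1 2] = [:: 0; 0]].
Proof.
rewrite /outer1 (table_map_values (m := 0) _ _ xE) // (table_map_values _ _ yE) //.
rewrite (table_map_values _ _ hE) //= !seval_neg !seval1 !seval0 !two_eqN1 //.
by rewrite opprK scale1r scaleN1r -!xE // -!yE.
Qed.

Lemma theta_values k : k \in [:: 1; 2]%N ->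
  table_map e co theta_table (x k) = y k /\
  table_map e co theta_table (y k) = - x k.
Proof.
rewrite !inE => /orP[] /eqP->; rewrite -!xE // -!yE //;
  by rewrite !(table_map_basis pres) // seval_neg seval1.
Qed.

End Values.

Theorem lemma2p12 (K : closedFieldType) (charK : 3%N \in [pchar K]) :
  let x := brj23_x K in
  let y := brj23_y K in
  let h := brj23_h K in
  [/\ is_basis ([seq x k | k <- iota 1 8] ++ [seq y k | k <- iota 1 8]
                ++ [seq h k | k <- iota 1 2]),
      (exists (D C : der (brj23 K)) (theta thetaV : brj23 K -> brj23 K),
        [/\ is_derivation true (val D),
            [/\ [seq val D (x k) | k <- iota 1 8] =
                  [:: 0; - y 4%N; 0; 2 *: y 2%N; 0; x 1%N; - x 3%N; 0],
                [seq val D (y k) | k <- iota 1 8] =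
                  [:: -2 *: y 6%N; 0; y 7%N; 0; 0; 0; 0; 0]
              & [seq val D (h k) | k <- iota 1 2] = [:: 0; 0]],
            [/\ is_automorphism theta, cancel theta thetaV,
                cancel thetaV theta,
                forall k, k \in [:: 1; 2]%N -> theta (x k) = y k
              & forall k, k \in [:: 1; 2]%N -> theta (y k) = - x k],
            val C = theta \o val D \o thetaV
          & is_basis [:: H1_class D; H1_class C]])
    & forall c : H2 (brj23 K), c = 0].
Proof.
move=> x y h; have pres := brj_presentation charK.
have xE : forall k, (k < 8)%N -> (brj_basis K)`_k = x k.+1 := @brj_basis_x K.
have yE : forall k, (k < 8)%N -> (brj_basis K)`_(8 + k) = y k.+1 := @brj_basis_y K.
have hE : forall k, (k < 2)%N -> (brj_basis K)`_(16 + k) = h k.+1 := @brj_basis_h K.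
split; first exact: brj_is_basis; last exact: (@H2_zero K charK (brj23 K) _ _ pres).
have [th_aut thK thVK] := theta_automorphism charK pres.
exists (outer1_der charK pres), (outer2_der charK pres).
exists (table_map (fun k => (brj_basis K)`_k) (brj_coord charK) theta_table).
exists (table_map (fun k => (brj_basis K)`_k) (brj_coord charK) theta_inv_table).
split; [exact: outer1_derivation|exact: (outer1_values charK pres xE yE hE)| |by []
  |exact: H1_basis].
by split=> // k /(theta_values pres xE yE)[].
Qed.
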